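(* Let $d\ge 2$ and let $\varphi=\sum_{i=0}^{d-1}\alpha_i e_i\otimes e_i\in\mathbb{C}^d\otimes\mathbb{C}^d$, where $\alpha_0\ge\cdots\ge\alpha_{d-1}>0$ and $\sum_{i=0}^{d-1}\alpha_i^2=1$. For $a=1,2$, let $\mathcal{M}_a\subseteq\mathcal{B}(\mathcal{H}_a)$ be a non-degenerate von Neumann algebra and let $(R_a,T_a,\psi_a)$ be a bipartite exact embezzlement protocol for $\varphi$ in $(\mathcal{M}_a,\mathcal{M}_a',\mathcal{H}_a)$. Let $\mathcal{N}_a$ be the von Neumann subalgebra of $\mathcal{M}_a$ generated by $\{R_{a,i0}: i=0,\dots,d-1\}$. Let $P_a$ (respectively $P_a'$) be the support projection of the state $\omega_a=\langle(\cdot)\psi_a,\psi_a\rangle$ on $\mathcal{N}_a$ (respectively of the state $\omega_a'=\langle(\cdot)\psi_a,\psi_a\rangle$ on $\mathcal{N}_a'$), and let $Q_a=P_aP_a'$. Let $V_{a,i}=Q_aR_{a,i0}^*Q_a$ and $W_{a,j}=Q_aT_{a,j0}^*Q_a$ for $i,j=0,\dots,d-1$, regarded as operators on $Q_a\mathcal{H}_a$. Then there is a unitary $U:Q_1\mathcal{H}_1\to Q_2\mathcal{H}_2$ satisfying: (1) $U\psi_1=\psi_2$; (2) $UV_{1,j}U^*=V_{2,j}$ and $UW_{1,j}U^*=W_{2,j}$ for all $j=0,\dots,d-1$; and (3) $U(Q_1\mathcal{N}_1Q_1)U^*=Q_2\mathcal{N}_2Q_2$ and $U(Q_1\mathcal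{N}_1'Q_1)U^*=Q_2\mathcal{N}_2'Q_2$.
   Context: $\{e_0,\dots,e_{d-1}\}$ is the canonical orthonormal basis of $\mathbb{C}^d$; inner products are linear in the first variable. $\mathcal{M}'$ denotes the commutant. Bipartite exact embezzlement protocol: for a von Neumann algebra $\mathcal{M}\subseteq\mathcal{B}(\mathcal{H})$, a triple $(R,T,\psi)$ is a (bipartite) exact embezzlement protocol for $\varphi$ in $(\mathcal{M},\mathcal{M}',\mathcal{H})$ if $R\in M_d\otimes\mathcal{M}$ (acting on $\mathbb{C}^d\otimes\mathcal{H}$) and $T\in\mathcal{M}'\otimes M_d$ (acting on $\mathcal{H}\otimes\mathbb{C}^d$) are contractions and $\psi\in\mathcal{H}$ is a unit vector with $(R\otimes I_d)(I_d\otimes T)(e_0\otimes\psi\otimes e_0)=\sum_{i=0}^{d-1}\alpha_i\,e_i\otimes\psi\otimes e_i$. Blocks: $R=\sum_{i,j}E_{ij}\otimes R_{ij}$ with $R_{ij}\in\mathcal{M}$ and $T=\sum_{i,j}T_{ij}\otimes E_{ij}$ with $T_{ij}\in\mathcal{M}'$, $E_{ij}$ the matrix units of $M_d$; $R_{a,ij}$, $T_{a,ij}$ are the blocks of $R_a$, $T_a$. The support projection of a vector state $\omega=\langle(\cdot)\psi,\psi\rangle$ on a von Neumann algebra $\mathcal{N}$ is $1-\sup\{X\in\mathcal{N}: X^2=X=X^*,\ \omega(X)=0\}\in\mathcal{N}$; it is the projection onto $\overline{\mathcal{N}'\psi}$. *)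

(* Defs.v *)
From HB Require Import structures.
From mathcomp Require Import all_boot all_order all_algebra.
From mathcomp Require Import complex.
From mathcomp Require Import all_classical all_reals all_analysis.

Set Implicit Arguments.
Unset Strict Implicit.
Unset Printing Implicit Defensive.

Import Order.TTheory GRing.Theory Num.Theory.
Import numFieldNormedType.Exports.

Local Open Scope classical_set_scope.
Local Open Scope ring_scope.
Local Open Scope complex_scope.

(* [inner] is linear in its first argument and conjugate-linear in its second. *)
HB.mixin Record hasInner (R : realType) H of GRing.Lmodule R[i] H := {
  inner : {dot H for @Num.conj R[i]}
}.

#[short(type="preHilbertType")]
HB.structure Definition PreHilbert (R : realType) :=
  {H of hasInner R H & GRing.Lmodule R[i] H}.

HB.mixin Record PreHilbert_isHilbert (R : realType) H
    of CompleteNormedModule R[i] H & PreHilbert R H := {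
  inner_normE : forall v : H,
    (inner : {dot H for @Num.conj R[i]}) v v = `|v| ^+ 2
}.

#[short(type="hilbertType")]
HB.structure Definition Hilbert (R : realType) :=
  {H of PreHilbert_isHilbert R H & CompleteNormedModule R[i] H
      & PreHilbert R H}.

Section FiniteDirectSum.
Context {R : realType} {I : finType} {H : preHilbertType R}.

Definition ffun_inner (u v : {ffun I -> H}) : R[i] :=
  \sum_i inner (u i) (v i).

Fact ffun_inner_bilinear :
  bilinear_for ( *%R : GRing.Scale.law _ _) (Num.conj \; *%R) ffun_inner.
Proof.
split=> [w a u v|w a u v]; rewrite /ffun_inner /= mulr_sumr -big_split /=;
  apply: eq_bigr => i _; rewrite !ffunE.
- by rewrite linearDl linearZl_LR.
- by rewrite linearDr linearZr_LR.
Qed.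

HB.instance Definition _ :=
  bilinear_isBilinear.Build _ _ _ _ _ _ ffun_inner ffun_inner_bilinear.

Fact ffun_innerC (u v : {ffun I -> H}) :
  ffun_inner u v = (-1) ^+ false * Num.conj (ffun_inner v u).
Proof.
rewrite mul1r /ffun_inner rmorph_sum; apply: eq_bigr => i _.
by rewrite [LHS]hermC mul1r.
Qed.

HB.instance Definition _ :=
  isHermitianSesquilinear.Build _ _ _ _ ffun_inner ffun_innerC.

Fact ffun_inner_gt0 (u : {ffun I -> H}) : u != 0 -> 0 < ffun_inner u u.
Proof.
move=> u0; have [i ui0] : exists i, u i != 0.
  apply/existsP; apply: contraNT u0 => /existsPn u0.
  by apply/eqP/ffunP => i; rewrite ffunE; apply/eqP; move: (u0 i); rewrite negbK.
rewrite /ffun_inner (bigD1 i) //= ltr_wpDr ?dnorm_gt0 //.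
by apply: sumr_ge0 => j _; exact: dnorm_ge0.
Qed.

HB.instance Definition _ := isDotProduct.Build _ _ ffun_inner ffun_inner_gt0.

HB.instance Definition _ := hasInner.Build R {ffun I -> H} ffun_inner.

End FiniteDirectSum.

Section LinearRange.
Context {R : realType} {H : preHilbertType R}.
Variable Q : {linear H -> H}.

Definition in_ran : {pred H} := [pred x | `[< exists y, Q y = x >]].

Fact in_ranP x : reflect (exists y, Q y = x) (x \in in_ran).
Proof. exact: asboolP. Qed.

Fact in_ran_submod : subsemimod_closed in_ran.
Proof.
split; [split|].
- by apply/in_ranP; exists 0; rewrite linear0.
- move=> _ _ /in_ranP[u <-] /in_ranP[v <-].
  by apply/in_ranP; exists (u + v); rewrite linearD.
- move=> a _ /in_ranP[u <-].
  by apply/in_ranP; exists (a *: u); rewrite linearZ.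
Qed.

HB.instance Definition _ :=
  GRing.isSubmodClosed.Build R[i] H in_ran in_ran_submod.

Record ran := Ran { ran_val :> H; _ : ran_val \in in_ran }.
HB.instance Definition _ := [isSub for ran_val].
HB.instance Definition _ := [Choice of ran by <:].
HB.instance Definition _ := [SubChoice_isSubLmodule of ran by <:].

Fact mem_ran x : Q x \in in_ran.
Proof. by apply/in_ranP; exists x. Qed.

Definition to_ran (x : H) : ran := Ran (mem_ran x).

Definition ran_inner (x y : ran) : R[i] := inner (ran_val x) (ran_val y).

Fact ran_inner_bilinear :
  bilinear_for ( *%R : GRing.Scale.law _ _) (Num.conj \; *%R) ran_inner.
Proof.
have valP a (u v : ran) : ran_val (a *: u + v) = a *: ran_val u + ran_val v.
  exact: (linearP (\val : ran -> H)).
split=> [w a u v|w a u v].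
- apply: etrans (congr1 (fun x => inner x (ran_val w)) (valP a u v)) _.
  by rewrite linearDl linearZl_LR.
- apply: etrans (congr1 (inner (ran_val w)) (valP a u v)) _.
  by rewrite linearDr linearZr_LR.
Qed.

HB.instance Definition _ :=
  bilinear_isBilinear.Build _ _ _ _ _ _ ran_inner ran_inner_bilinear.

Fact ran_innerC (u v : ran) :
  ran_inner u v = (-1) ^+ false * Num.conj (ran_inner v u).
Proof. exact: hermC. Qed.

HB.instance Definition _ :=
  isHermitianSesquilinear.Build _ _ _ _ ran_inner ran_innerC.

Fact ran_inner_gt0 (u : ran) : u != 0 -> 0 < ran_inner u u.
Proof. by rewrite /ran_inner dnorm_gt0. Qed.

HB.instance Definition _ := isDotProduct.Build _ _ ran_inner ran_inner_gt0.

HB.instance Definition _ := hasInner.Build R ran ran_inner.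

End LinearRange.

Arguments to_ran {R H} Q x.

Section Operators.
Context {R : realType}.

Definition is_adjoint (H K : preHilbertType R) (X : H -> K) (Y : K -> H) :=
  forall u v, inner (X u) v = inner u (Y v).

(* For a bounded [X] between Hilbert spaces the adjoint exists and is unique,
   so the default value is not used. *)
Definition adjoint (H K : preHilbertType R) (X : H -> K) : K -> H :=
  xget 0 [set Y | is_adjoint X Y].

Definition contraction (H K : preHilbertType R) (X : H -> K) :=
  forall v, inner (X v) (X v) <= inner v v.

Definition unitary (H K : preHilbertType R) (U : H -> K) :=
  [/\ linear U, forall u v, inner (U u) (U v) = inner u v
    & forall y, exists x, U x = y].

Definition bounded_op (H : hilbertType R) : set (H -> H) :=
  [set X | linear X /\ exists k : R[i], forall v, `|X v| <= k * `|v|].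

End Operators.

Section VonNeumann.
Context {R : realType} {H : hilbertType R}.
Implicit Types (A N : set (H -> H)) (X Y P E F : H -> H).

Definition star_subalgebra A :=
  [/\ A `<=` @bounded_op R H, A 0
    , forall X Y, A X -> A Y -> A (X + Y)
    , forall (c : R[i]) X, A X -> A (c *: X)
    & (forall X Y, A X -> A Y -> A (X \o Y)) /\
      (forall X, A X -> A (adjoint X))].

(* Closed in [bounded_op] for the weak operator topology. *)
Definition wot_closed A :=
  forall X, bounded_op X ->
    (forall (s : seq (H * H)) (e : R[i]), 0 < e ->
      exists2 Y, A Y & {in s, forall p, `|inner (X p.1 - Y p.1) p.2| < e}) ->
    A X.

Definition von_neumann A := star_subalgebra A /\ wot_closed A.

Definition nondegenerate_algebra A :=
  closure [set v | exists n (X : 'I_n -> H -> H) (w : 'I_n -> H),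
    (forall k, A (X k)) /\ v = \sum_k X k (w k)] = setT.

Definition commutant A : set (H -> H) :=
  [set X | bounded_op X /\ forall Y, A Y -> X \o Y = Y \o X].

(* Subalgebras share the unit of B(H).  If S is contained in a nondegenerate
   von Neumann algebra M, then M is one of the algebras intersected, so that
   this is the von Neumann subalgebra of M generated by S. *)
Definition generated_von_neumann (S : set (H -> H)) : set (H -> H) :=
  [set X | forall A, von_neumann A -> nondegenerate_algebra A -> S `<=` A -> A X].

Definition projection P := [/\ bounded_op P, P \o P = P & is_adjoint P P].

Definition op_le X Y := forall v, inner (X v) v <= inner (Y v) v.

Definition is_sup_projection (S : set (H -> H)) E :=
  [/\ projection E, forall X, S X -> op_le X E
    & forall F, projection F -> (forall X, S X -> op_le X F) -> op_le E F].

Definition is_support N (psi : H) P :=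
  exists2 E,
    is_sup_projection [set X | [/\ N X, projection X & inner (X psi) psi = 0]] E
  & P = idfun - E.

(* Q X Q as an operator on Q H. *)
Definition compress (Q : {linear H -> H}) X : ran Q -> ran Q :=
  fun x => to_ran Q (X (Q (ran_val x))).
Arguments compress : clear implicits.

Definition corner (Q : {linear H -> H}) N : set (ran Q -> ran Q) :=
  [set compress Q X | X in N].

End VonNeumann.

Arguments compress {R H} Q X x.
Arguments corner {R H} Q N.

Section Embezzlement.
Context {R : realType} {H : hilbertType R} {d : nat}.
Implicit Types (A B : 'M[H -> H]_d) (psi : H).

(* C^d (x) H and H (x) C^d are both represented by d-tuples of vectors of H,
   and C^d (x) H (x) C^d by families indexed by pairs; M_d (x) M is represented
   by the d x d matrices of blocks in M. *)
Definition block_op A (xi : {ffun 'I_d -> H}) : {ffun 'I_d -> H} :=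
  [ffun i => \sum_j A i j (xi j)].

Definition op_tensor_id A (xi : {ffun 'I_d * 'I_d -> H}) :
    {ffun 'I_d * 'I_d -> H} :=
  [ffun p => \sum_j A p.1 j (xi (j, p.2))].

Definition id_tensor_op B (xi : {ffun 'I_d * 'I_d -> H}) :
    {ffun 'I_d * 'I_d -> H} :=
  [ffun p => \sum_j B p.2 j (xi (p.1, j))].

Definition etensor (i : 'I_d) psi (j : 'I_d) : {ffun 'I_d * 'I_d -> H} :=
  [ffun p => if p == (i, j) then psi else 0].

(* [o] is the index 0 of the canonical basis. *)
Definition embezzlement_protocol (o : 'I_d) (alpha : 'I_d -> R)
    (M : set (H -> H)) A B psi :=
  [/\ (forall i j, M (A i j)) /\ contraction (block_op A)
    , (forall i j, commutant M (B i j)) /\ contraction (block_op B)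
    , `|psi| = 1
    & op_tensor_id A (id_tensor_op B (etensor o psi o)) =
      \sum_i (alpha i)%:C *: etensor i psi i].

End Embezzlement.

(* Main.v *)
Require Import Defs.
From HB Require Import structures.
From mathcomp Require Import all_boot all_order all_algebra.
From mathcomp Require Import complex.
From mathcomp Require Import all_classical all_reals all_analysis.
From mathcomp Require Import ring lra zify.

Set Implicit Arguments.
Unset Strict Implicit.
Unset Printing Implicit Defensive.

Import Order.TTheory GRing.Theory Num.Theory.
Import numFieldNormedType.Exports.

Local Open Scope classical_set_scope.
Local Open Scope ring_scope.

(** Write r_i = R_{i0} and t_j = T_{j0}.  The protocol gives r_i t_j psi =
    delta_ij alpha_i psi, and equality in the two contraction estimates forces
    t_j psi = alpha_j r_j^* psi and r_i psi = alpha_i t_i^* psi.  Since the t_j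
    commute with the r_i and r_i^*, on the cyclic space K generated by psi one has
    r_i r_j^* = delta_ij, and the vector state satisfies the KMS-type rule
    <r_i x psi, psi> = alpha_i^-2 <x r_i psi, psi>.  These rules determine the
    moments of all words in r_i, r_i^*, so w(r_1) psi_1 |-> w(r_2) psi_2 extends to
    a unitary between the two cyclic spaces, and it also intertwines the t_j^*.

    The projection onto K is the support of psi on N', and it lies below the support
    of psi on N; hence Q is the projection onto K.  The corner of N' consists of the
    operators on K commuting with the r_i and r_i^*, and the corner of N is the
    commutant of that algebra: an operator Z commuting with it lifts to N by
    n' psi |-> n' Z psi for n' in N'.  Both descriptions are transported by the
    unitary. *)

(** * Inner product spaces *)

(** Why the rules determine the moments: a word containing no [r_i r_j^*] has all its adjoint
    letters on the left. If both kinds of letters occur, moving the last [r_j] to the front creates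
    a factor [r_j r_i^*] and shortens the word. If only one kind occurs, a full rotation multiplies
    the moment by a product of powers [alpha_i^2], or of their inverses, which is not 1 because
    [alpha_i < 1], a consequence of [d >= 2]; hence the moment vanishes. Why K lies below the
    support on N: on [psi] each letter may be exchanged for a multiple of some [t_j] or [t_j^*], so
    every word applied to [psi] is an element of N' applied to [psi]. The delicate point is the lift
    [n' psi |-> n' Z psi]. It is neither visibly well defined nor visibly bounded, since [Z]
    commutes only with the corner of N' while [n'] is an arbitrary element of N'. One estimate,
    [|n' Z psi|^2 <= q |n' psi|^2] with [q] independent of [n'], settles both. *)

Section InnerProduct.
Context {R : realType} {H : preHilbertType R}.
Implicit Types (u v w : H) (c : R[i]).

Lemma innerC u v : inner u v = (inner v u)^*.
Proof. by rewrite [LHS]hermC mul1r. Qed.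

Lemma innerDl u v w : inner (u + v) w = inner u w + inner v w.
Proof. exact: linearDl. Qed.

Lemma innerDr u v w : inner u (v + w) = inner u v + inner u w.
Proof. exact: linearDr. Qed.

Lemma innerZl c u v : inner (c *: u) v = c * inner u v.
Proof. exact: linearZl_LR. Qed.

Lemma innerZr c u v : inner u (c *: v) = c^* * inner u v.
Proof. exact: linearZr_LR. Qed.

Lemma inner0l v : inner 0 v = 0.
Proof. exact: linear0l. Qed.

Lemma inner0r v : inner v 0 = 0.
Proof. exact: linear0r. Qed.

Lemma innerNl u v : inner (- u) v = - inner u v.
Proof. exact: linearNl. Qed.

Lemma innerBl u v w : inner (u - v) w = inner u w - inner v w.
Proof. exact: linearBl. Qed.

Lemma innerBr u v w : inner u (v - w) = inner u v - inner u w.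
Proof. exact: linearBr. Qed.

Lemma inner_suml (I : Type) (r : seq I) (P : pred I) (F : I -> H) v :
  inner (\sum_(i <- r | P i) F i) v = \sum_(i <- r | P i) inner (F i) v.
Proof. exact: (big_morph (fun x => inner x v) (fun x y => innerDl x y v) (inner0l v)). Qed.

Lemma inner_sumr (I : Type) (r : seq I) (P : pred I) (F : I -> H) v :
  inner v (\sum_(i <- r | P i) F i) = \sum_(i <- r | P i) inner v (F i).
Proof. exact: (big_morph (inner v) (innerDr v) (inner0r v)). Qed.

Lemma inner_ext u v : (forall w, inner u w = inner v w) -> u = v.
Proof.
move=> uv; apply/eqP; rewrite -subr_eq0 -(dnorm_eq0 inner).
by rewrite innerBl uv subrr.
Qed.

(** Real-valued inner products and squared norms turn analytic estimates into polynomial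
    inequalities over [R], which [lra] and [nra] can close without square roots. *)
Definition re_inner u v : R := complex.Re (inner u v).
Definition sqnorm v : R := re_inner v v.

Lemma re_innerC u v : re_inner u v = re_inner v u.
Proof. by rewrite /re_inner innerC; case: (inner v u). Qed.

Lemma re_innerDl u v w : re_inner (u + v) w = re_inner u w + re_inner v w.
Proof. by rewrite /re_inner innerDl; case: (inner u w) (inner v w) => ? ? []. Qed.

Lemma re_innerNl u v : re_inner (- u) v = - re_inner u v.
Proof. by rewrite /re_inner innerNl; case: (inner u v). Qed.

Lemma re_innerDr u v w : re_inner u (v + w) = re_inner u v + re_inner u w.
Proof. by rewrite re_innerC re_innerDl !(re_innerC u). Qed.

Lemma re_innerNr u v : re_inner u (- v) = - re_inner u v.
Proof. by rewrite re_innerC re_innerNl re_innerC. Qed.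

Lemma re_innerZl (t : R) u v : re_inner (t%:C%C *: u) v = t * re_inner u v.
Proof. by rewrite /re_inner innerZl; case: (inner u v) => a b /=; rewrite mul0r subr0. Qed.

Lemma re_innerZr (t : R) u v : re_inner u (t%:C%C *: v) = t * re_inner u v.
Proof. by rewrite re_innerC re_innerZl re_innerC. Qed.

Lemma inner_sqnorm v : inner v v = (sqnorm v)%:C%C.
Proof.
have /eqP := innerC v v; rewrite /sqnorm /re_inner.
case: (inner v v) => a b; rewrite eq_complex /= => /andP[_ /eqP bb].
by congr Complex; lra.
Qed.

Lemma sqnorm_ge0 v : 0 <= sqnorm v.
Proof. by rewrite -lecR -inner_sqnorm dnorm_ge0. Qed.

Lemma sqnorm_eq0 v : sqnorm v = 0 -> v = 0.
Proof.
by move=> v0; apply/eqP; rewrite -(dnorm_eq0 inner) inner_sqnorm v0.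
Qed.

Lemma sqnorm0 : sqnorm 0 = 0.
Proof. by rewrite /sqnorm /re_inner inner0l. Qed.

Lemma sqnormN v : sqnorm (- v) = sqnorm v.
Proof. by rewrite /sqnorm re_innerNl re_innerNr opprK. Qed.

Lemma sqnormBC u v : sqnorm (u - v) = sqnorm (v - u).
Proof. by rewrite -sqnormN opprB. Qed.

Lemma sqnormD u v : sqnorm (u + v) = sqnorm u + sqnorm v + 2 * re_inner u v.
Proof.
rewrite /sqnorm re_innerDl !re_innerDr (re_innerC v u); ring.
Qed.

Lemma sqnormB u v : sqnorm (u - v) = sqnorm u + sqnorm v - 2 * re_inner u v.
Proof. by rewrite sqnormD sqnormN re_innerNr; ring. Qed.

Lemma sqnormZ (c : R[i]) v :
  sqnorm (c *: v) = (complex.Re c ^+ 2 + complex.Im c ^+ 2) * sqnorm v.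
Proof.
rewrite {1}/sqnorm /re_inner innerZl innerZr inner_sqnorm.
by case: c => a b /=; ring.
Qed.

Lemma sqnormZr (t : R) v : sqnorm (t%:C%C *: v) = t ^+ 2 * sqnorm v.
Proof. by rewrite sqnormZ /= expr0n addr0. Qed.

Lemma sqnormD_le u v : sqnorm (u + v) <= 2 * sqnorm u + 2 * sqnorm v.
Proof.
have := sqnorm_ge0 (u - v); rewrite sqnormB sqnormD; lra.
Qed.

Lemma sqnormB_le u v : sqnorm (u - v) <= 2 * sqnorm u + 2 * sqnorm v.
Proof. by rewrite -(sqnormN v) sqnormD_le. Qed.

Lemma sqnorm_tri w u v :
  sqnorm (u - v) <= 2 * sqnorm (u - w) + 2 * sqnorm (v - w).
Proof.
have -> : u - v = (u - w) - (v - w) by rewrite opprB addrA subrK.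
exact: sqnormB_le.
Qed.

Lemma re_inner_le u v : 2 * re_inner u v <= sqnorm u + sqnorm v.
Proof. by have := sqnorm_ge0 (u - v); rewrite sqnormB; lra. Qed.

(** Cauchy-Schwarz for the real part: expand the squared norm of [|u|^2 v - Re <u, v> u] and cancel
    [|u|^2]. *)
Lemma re_inner_sqr_le u v : re_inner u v ^+ 2 <= sqnorm u * sqnorm v.
Proof.
have [u0|u0] := eqVneq (sqnorm u) 0.
  by rewrite u0 (sqnorm_eq0 u0) /re_inner inner0l /=; lra.
have up : 0 < sqnorm u by rewrite lt_def u0 sqnorm_ge0.
have := sqnorm_ge0 ((sqnorm u)%:C%C *: v - (re_inner u v)%:C%C *: u).
rewrite sqnormB !sqnormZr re_innerZl re_innerZr (re_innerC v).
by nra.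
Qed.

(** The scalar 1 recovers the real part and the scalar [i] the imaginary part up to sign. *)
Lemma re_inner_eq u v u' v' :
  (forall c : R[i], re_inner (c *: u) v = re_inner (c *: u') v') ->
  inner u v = inner u' v'.
Proof.
move=> h; have := h 1; have := h 'i%C.
rewrite !scale1r /re_inner !innerZl.
case: (inner u v) (inner u' v') => a b [a' b'] /=.
by rewrite !mul0r !mul1r !sub0r => /oppr_inj -> ->.
Qed.

(** The norm closure, phrased with [sqnorm] so that it makes sense in spaces that carry an inner
    product but no declared topology, such as finite direct sums. *)
Definition adherent (S : set H) : set H :=
  [set v | forall e : R, 0 < e -> exists2 s, S s & sqnorm (v - s) < e].

Lemma sub_adherent S : S `<=` adherent S.
Proof. by move=> v Sv e e0; exists v => //; rewrite subrr sqnorm0. Qed.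

Lemma adherentK S : adherent (adherent S) `<=` adherent S.
Proof.
move=> v vS e e0; have e4 : 0 < e / 4 by lra.
have [s /(_ _ e4)[t St st] vs] := vS _ e4; exists t => //.
have := sqnorm_tri s v t; rewrite (sqnormBC t); lra.
Qed.

Definition subspace (S : set H) := [/\ S 0, forall u v, S u -> S v -> S (u + v)
  & forall c v, S v -> S (c *: v)].

Lemma subspaceB S : subspace S -> forall u v, S u -> S v -> S (u - v).
Proof. by case=> _ SD SZ u v Su Sv; rewrite -scaleN1r; apply/SD/SZ. Qed.

Lemma adherent_subspace S : subspace S -> subspace (adherent S).
Proof.
case=> S0 SD SZ; split=> [|u v uS vS e e0|c v vS e e0].
- exact: sub_adherent.
- have e4 : 0 < e / 4 by lra.
  have [s Ss us] := uS _ e4; have [t St vt] := vS _ e4.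
  exists (s + t); first exact: SD.
  have := sqnormD_le (u - s) (v - t); rewrite addrACA -opprD; lra.
- pose k := complex.Re c ^+ 2 + complex.Im c ^+ 2.
  have k0 : 0 <= k by rewrite addr_ge0 ?sqr_ge0.
  have k1 : 0 < k + 1 by lra.
  have ek : 0 < e / (k + 1) by rewrite divr_gt0.
  have [s Ss vs] := vS _ ek; exists (c *: s); first exact: SZ.
  rewrite -scalerBr sqnormZ -/k.
  have : (k + 1) * sqnorm (v - s) < e by rewrite mulrC -ltr_pdivlMr.
  have := sqnorm_ge0 (v - s); nra.
Qed.

End InnerProduct.

(** * Bounded linear maps and their adjoints *)

Definition bounded (R : realType) (H K : preHilbertType R) (X : H -> K) :=
  exists k : R, 0 <= k /\ forall v, sqnorm (X v) <= k * sqnorm v.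

Definition bounded_linear (R : realType) (H K : preHilbertType R) (X : H -> K) :=
  linear X /\ bounded X.

Section BoundedMaps.
Context {R : realType} {H K : preHilbertType R}.
Implicit Types (X Y : H -> K).

Lemma lin_comb X : linear X ->
  [/\ X 0 = 0, forall u v, X (u + v) = X u + X v,
      forall u v, X (u - v) = X u - X v, forall c v, X (c *: v) = c *: X v
    & forall (I : Type) (r : seq I) (P : pred I) (F : I -> H),
      X (\sum_(i <- r | P i) F i) = \sum_(i <- r | P i) X (F i)].
Proof.
move=> lX; have XD u v : X (u + v) = X u + X v.
  by have := lX 1 u v; rewrite !scale1r.
have X0 : X 0 = 0 by apply: (addrI (X 0)); rewrite -XD !addr0.
have XZ c v : X (c *: v) = c *: X v by have := lX c v 0; rewrite X0 !addr0.
split=> //; first by move=> u v; rewrite XD -scaleN1r XZ scaleN1r.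
by move=> I r P F; exact: (big_morph X XD X0).
Qed.

Lemma lin0 X : linear X -> X 0 = 0. Proof. by case/lin_comb. Qed.
Lemma linD X : linear X -> forall u v, X (u + v) = X u + X v.
Proof. by case/lin_comb. Qed.
Lemma linB X : linear X -> forall u v, X (u - v) = X u - X v.
Proof. by case/lin_comb. Qed.
Lemma linZ X : linear X -> forall c v, X (c *: v) = c *: X v.
Proof. by case/lin_comb. Qed.
Lemma linS X : linear X ->
  forall (I : Type) (r : seq I) (P : pred I) (F : I -> H),
  X (\sum_(i <- r | P i) F i) = \sum_(i <- r | P i) X (F i).
Proof. by case/lin_comb. Qed.

Lemma bounded_eq_adherent X Y S : bounded_linear X -> bounded_linear Y ->
  (forall v, S v -> X v = Y v) -> forall v, adherent S v -> X v = Y v.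
Proof.
move=> [lX [k [k0 Xk]]] [lY [l [l0 Yl]]] XY v vS; apply/eqP; rewrite -subr_eq0.
apply/eqP/sqnorm_eq0/eqP; rewrite eq_le sqnorm_ge0 andbT; apply/ler_addgt0Pl => e e0.
have m0 : 0 < 2 * k + 2 * l + 1 by lra.
have [s Ss vs] := vS _ (divr_gt0 e0 m0).
have -> : X v - Y v = X (v - s) - Y (v - s).
  by rewrite (linB lX) (linB lY) (XY _ Ss) opprB addrA subrK.
rewrite addr0; apply: le_trans (sqnormB_le _ _) _.
move: vs; rewrite ltr_pdivlMr // => vs.
have := Xk (v - s); have := Yl (v - s); have := sqnorm_ge0 (v - s); nra.
Qed.

Lemma bounded_adherent X (S : set H) (T : set K) : bounded_linear X ->
  (forall v, S v -> adherent T (X v)) ->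
  forall v, adherent S v -> adherent T (X v).
Proof.
move=> [lX [k [k0 Xk]]] XST v vS; apply: adherentK => e e0.
have k1 : 0 < k + 1 by lra.
have [s Ss vs] := vS _ (divr_gt0 e0 k1); exists (X s); first exact: XST.
rewrite -(linB lX); apply: le_lt_trans (Xk _) _.
move: vs; rewrite ltr_pdivlMr // => vs; have := sqnorm_ge0 (v - s); nra.
Qed.

Lemma is_adjoint_unique X (Y Z : K -> H) : is_adjoint X Y -> is_adjoint X Z -> Y = Z.
Proof.
move=> XY XZ; apply/funext => v; apply: inner_ext => w.
by rewrite innerC -XY XZ -innerC.
Qed.

Lemma adjoint_eq X (Y : K -> H) : is_adjoint X Y -> adjoint X = Y.
Proof. by move=> XY; apply: xget_subset1 => // Z W; exact: is_adjoint_unique. Qed.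

Lemma is_adjointC X (Y : K -> H) : is_adjoint X Y -> is_adjoint Y X.
Proof. by move=> XY u v; rewrite innerC -XY -innerC. Qed.

Lemma is_adjoint_linear X (Y : K -> H) : is_adjoint X Y -> linear Y.
Proof.
move=> XY c u v; apply: inner_ext => w.
rewrite innerC -XY innerDr innerZr !XY innerDl innerZl.
by rewrite rmorphD rmorphM /= conjCK -!innerC.
Qed.

(** Cauchy-Schwarz applied to [|Y v|^2 = Re <X (Y v), v>] gives [|Y v|^4 <= k |Y v|^2 |v|^2]; one
    factor cancels. *)
Lemma is_adjoint_bounded X (Y : K -> H) : is_adjoint X Y -> bounded X -> bounded Y.
Proof.
move=> XY [k [k0 Xk]]; exists k; split=> // v.
have [->|Yv] := eqVneq (sqnorm (Y v)) 0; first by rewrite mulr_ge0 ?sqnorm_ge0.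
have Y0 : 0 < sqnorm (Y v) by rewrite lt_def Yv sqnorm_ge0.
have E : re_inner (X (Y v)) v = sqnorm (Y v) by rewrite /re_inner XY.
have := re_inner_sqr_le (X (Y v)) v; have := Xk (Y v).
rewrite E => h1 h2; have := sqnorm_ge0 v => h3.
by rewrite -(ler_pM2l Y0) -expr2; apply: le_trans h2 _; nra.
Qed.

End BoundedMaps.

(** * Orthogonal projections and adjoints *)

Definition complete_inner (R : realType) (H : preHilbertType R) :=
  forall u : nat -> H,
  (forall e : R, 0 < e -> exists N, forall m n, (N <= m)%N -> (N <= n)%N ->
     sqnorm (u m - u n) < e) ->
  exists l, forall e : R, 0 < e ->
    exists N, forall n, (N <= n)%N -> sqnorm (u n - l) < e.

(** [S] need not be closed: the values lie in its closure while orthogonality is tested on [S] only.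
    This suits orbits of vectors, which are merely dense in the spaces of interest. *)
Definition is_orthogonal_projection (R : realType) (H : preHilbertType R)
    (S : set H) (G : H -> H) :=
  forall v, adherent S (G v) /\ forall l, S l -> inner (v - G v) l = 0.

Section Projection.
Context {R : realType} {H : preHilbertType R}.
Implicit Types (S : set H) (G : H -> H).

Lemma invS_small (e : R) : 0 < e -> exists N : nat, forall n, (N <= n)%N -> n.+1%:R^-1 < e.
Proof.
move=> e0; exists (Num.truncn e^-1) => n Nn.
rewrite -ltf_pV2 ?(posrE, invr_gt0, ltr0n)// invrK.
by apply: lt_le_trans (truncnS_gt _) _; rewrite ler_nat.
Qed.

Lemma orthogonal_adherent S w : (forall l, S l -> inner w l = 0) ->
  forall l, adherent S l -> inner w l = 0.
Proof.
move=> wS l lS; rewrite -(inner0l l); apply: re_inner_eq => c.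
rewrite scaler0 [RHS]/re_inner inner0l /=.
have cS s : S s -> re_inner (c *: w) s = 0.
  by move=> Ss; rewrite /re_inner innerZl wS // mulr0.
apply/eqP; rewrite -sqrf_eq0 eq_le sqr_ge0 andbT; apply/ler_addgt0Pl => e e0.
have k1 : 0 < sqnorm (c *: w) + 1 by have := sqnorm_ge0 (c *: w); lra.
have [s Ss] := lS _ (divr_gt0 e0 k1); rewrite ltr_pdivlMr // => ls.
have -> : re_inner (c *: w) l = re_inner (c *: w) (l - s).
  by rewrite re_innerDr re_innerNr (cS s) // subr0.
apply: le_trans (re_inner_sqr_le _ _) _.
have := sqnorm_ge0 (c *: w); have := sqnorm_ge0 (l - s); nra.
Qed.

(** Replacing [m] by [t m] with [t > 0] and dividing by [t] makes the right side arbitrarily small;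
    then [- m] and complex multiples of [m] give the full inner product. *)
Lemma orthogonal_of_variation (w : H) S : subspace S ->
  (forall m, S m -> 2 * re_inner w m <= 2 * sqnorm m) ->
  forall l, S l -> inner w l = 0.
Proof.
move=> [_ _ SZ] wS l Sl.
have re_le m : S m -> re_inner w m <= 0.
  move=> Sm; apply/ler_addgt0Pl => e e0; rewrite addr0.
  have k1 : 0 < sqnorm m + 1 by have := sqnorm_ge0 m; lra.
  pose t := e / (sqnorm m + 1); have t0 : 0 < t by rewrite divr_gt0.
  have := wS _ (SZ t%:C%C _ Sm); rewrite re_innerZr sqnormZr.
  have m0 := sqnorm_ge0 m => h; rewrite -(ler_pM2l t0).
  have te : t * (sqnorm m + 1) = e by rewrite /t divfK ?gt_eqF.
  by rewrite -te; nra.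
have re0 m : S m -> re_inner w m = 0.
  move=> Sm; have := re_le _ Sm; have := re_le _ (SZ (-1) _ Sm).
  rewrite scaleN1r re_innerNr; lra.
rewrite innerC -[RHS](conjC0) -(inner0l w); congr (_^*).
apply: re_inner_eq => c; rewrite scaler0 re_innerC re0; last exact: SZ.
by rewrite /re_inner inner0l.
Qed.

(** A minimizing sequence for the distance from [v] to [S] is Cauchy by the parallelogram law, as
    midpoints stay in [S]; its limit is the projection. *)
Lemma orthogonal_projection_at S : complete_inner H -> subspace S ->
  forall v, exists g, adherent S g /\ forall l, S l -> inner (v - g) l = 0.
Proof.
move=> Hc sS v; have [S0 SD SZ] := sS.
pose D := [set sqnorm (v - l) | l in S]; pose d := inf D.
have Dinf : has_inf D.
  split; first by exists (sqnorm (v - 0)); exists 0.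
  by exists 0 => _ [l _ <-]; exact: sqnorm_ge0.
have dle l : S l -> d <= sqnorm (v - l) by move=> Sl; apply: (ge_inf Dinf.2); exists l.
have /choice[l lP] : forall n : nat, exists l, S l /\ sqnorm (v - l) < d + n.+1%:R^-1.
  move=> n; have n0 : 0 < n.+1%:R^-1 :> R by rewrite invr_gt0 ltr0n.
  by have [_ [l Sl <-] ?] := inf_adherent n0 Dinf; exists l.
have lS n : S (l n) by case: (lP n).
have lv n : sqnorm (v - l n) < d + n.+1%:R^-1 by case: (lP n).
have [|g gP] := Hc l.
  move=> e e0; have [N NP] := invS_small (divr_gt0 e0 (ltr0n R 4)).
  exists N => m n /NP mN /NP nN.
  have half2 : (2 : R)%:C%C * (2^-1 : R)%:C%C = 1 :> R[i].
    by rewrite -rmorphM /= mulfV ?pnatr_eq0.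
  pose a := v - l m; pose b := v - l n.
  have E : a + b = (2 : R)%:C%C *: (v - (2^-1 : R)%:C%C *: (l m + l n)).
    rewrite scalerBr scalerA half2 scale1r rmorph_nat scaler_nat mulr2n.
    by rewrite opprD addrACA.
  have : 4 * d <= sqnorm (a + b).
    rewrite E sqnormZr (_ : 2 ^+ 2 = 4) ?ler_pM2l //; last by ring.
    by apply/dle/SZ/SD.
  have -> : l m - l n = b - a by rewrite /a /b opprB [RHS]addrC addrA subrK.
  have := lv m; have := lv n; rewrite -/a -/b (sqnormD a b) (sqnormB b a) (re_innerC b).
  move: (m.+1%:R^-1) (n.+1%:R^-1) mN nN => m1 n1; clearbody d; lra.
exists g; split.
  move=> e /gP[N NP]; exists (l N) => //; rewrite sqnormBC; exact: NP.
(* Of the two copies of [sqnorm m] on the right, one comes from minimality of [d] at [l n + m] and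
   the other from the error term pairing [l n - g] with [m]. *)
apply: orthogonal_of_variation => // m Sm.
apply/ler_addgt0Pl => e e0.
have e2 : 0 < e / 2 by lra.
have [N NP] := gP _ e2; have [N' NP'] := invS_small e2.
pose n := maxn N N'.
have := NP n (leq_maxl _ _); have := NP' n (leq_maxr _ _) => h1 h2.
have := dle _ (SD _ _ (lS n) Sm); have := lv n => h3.
rewrite opprD addrA sqnormB => h4.
have := re_inner_le (l n - g) m => h5.
have -> : v - g = (v - l n) + (l n - g) by rewrite addrA subrK.
by rewrite re_innerDl; move: (n.+1%:R^-1) h1 h3 => n1 h1 h3; clearbody d; lra.
Qed.

Lemma orthogonal_projection_exists S : complete_inner H -> subspace S ->
  exists G, is_orthogonal_projection S G.
Proof.
by move=> Hc sS; have /choice[G GP] := orthogonal_projection_at Hc sS; exists G.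
Qed.

Section Theory.
Variables (S : set H) (G : H -> H).
Hypotheses (sS : subspace S) (GP : is_orthogonal_projection S G).

Lemma proj_adherent v : adherent S (G v). Proof. by case: (GP v). Qed.

Lemma proj_orthogonal v l : adherent S l -> inner (v - G v) l = 0.
Proof. by apply: orthogonal_adherent; case: (GP v). Qed.

Lemma proj_unique v g : adherent S g -> (forall l, S l -> inner (v - g) l = 0) ->
  g = G v.
Proof.
move=> gS gP; apply/eqP; rewrite -subr_eq0 -(dnorm_eq0 inner).
have aS : adherent S (g - G v).
  by apply: subspaceB gS (proj_adherent v); exact: adherent_subspace.
have {1}-> : g - G v = (v - G v) - (v - g) by rewrite opprB [RHS]addrC addrA subrK.
by rewrite innerBl proj_orthogonal // (orthogonal_adherent gP aS) subrr.
Qed.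

Lemma proj_id v : adherent S v -> G v = v.
Proof. by move=> vS; symmetry; apply: proj_unique => // l _; rewrite subrr inner0l. Qed.

Lemma projK v : G (G v) = G v.
Proof. exact/proj_id/proj_adherent. Qed.

Lemma proj_linear : linear G.
Proof.
move=> c u v; symmetry; apply: proj_unique.
  have [_ aD aZ] := adherent_subspace sS.
  by apply: aD (proj_adherent _); apply: aZ (proj_adherent _).
move=> l /sub_adherent Sl.
rewrite opprD addrACA -scalerBr innerDl innerZl.
by rewrite !proj_orthogonal // mulr0 addr0.
Qed.

Lemma proj_adjoint : is_adjoint G G.
Proof.
move=> u v; have h x y : inner (G x) y = inner (G x) (G y).
  apply/eqP; rewrite -subr_eq0 -innerBr innerC proj_orthogonal ?conjC0 //.
  exact: proj_adherent.
by rewrite (h u v) [RHS]innerC (h v u) -innerC.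
Qed.

Lemma proj_sqnorm_le v : sqnorm (G v) <= sqnorm v.
Proof.
have E : re_inner v (G v) = sqnorm (G v) by rewrite /sqnorm /re_inner proj_adjoint projK.
have := sqnorm_ge0 (v - G v); rewrite sqnormB E; lra.
Qed.

Lemma proj_bounded : bounded_linear G.
Proof.
split; first exact: proj_linear.
by exists 1; split=> // v; rewrite mul1r proj_sqnorm_le.
Qed.

(** Invariance under the adjoint is what makes [X (v - G v)] orthogonal to [S]; invariance under [X]
    keeps [X (G v)] in the closure. *)
Lemma proj_commute (X Y : H -> H) : bounded_linear X -> is_adjoint X Y ->
  (forall l, S l -> adherent S (X l)) -> (forall l, S l -> adherent S (Y l)) ->
  forall v, X (G v) = G (X v).
Proof.
move=> Xb XY XS YS v; apply: proj_unique.
  exact: bounded_adherent Xb XS _ (proj_adherent v).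
move=> l Sl; rewrite -(linB Xb.1) XY; apply: proj_orthogonal; exact: YS.
Qed.

End Theory.

End Projection.

(** The functional [v |-> <X v, w>] has a closed kernel [S]. Unless it vanishes identically, some
    [n] orthogonal to [S] lies outside [S], and a multiple of [n] represents the functional. *)
Lemma riesz (R : realType) (H K : preHilbertType R) (X : H -> K) : complete_inner H ->
  bounded_linear X -> exists Y, is_adjoint X Y.
Proof.
move=> Hc Xb; have [lX _] := Xb.
suff /choice[Y YP] : forall w, exists z, forall v, inner (X v) w = inner v z.
  by exists Y => u v; exact: YP.
move=> w; pose S := [set v | inner (X v) w = 0].
have sS : subspace S.
  split=> [|u v|c v]; rewrite /S /=; first by rewrite (lin0 lX) inner0l.
    by rewrite (linD lX) innerDl => -> ->; rewrite addr0.
  by rewrite (linZ lX) innerZl => ->; rewrite mulr0.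
have [G GP] := orthogonal_projection_exists Hc sS.
have [wX|] := pselect (forall v, inner (X v) w = 0).
  by exists 0 => v; rewrite wX inner0r.
move=> /existsNP[v0 v0P]; pose n := v0 - G v0.
have Sclosed v : adherent S v -> S v.
  move=> vS; rewrite /S /= innerC (@orthogonal_adherent R K (X @` S) w) ?conjC0 //.
    by move=> _ [u Su <-]; rewrite innerC Su conjC0.
  by apply: bounded_adherent Xb _ _ vS => u Su; apply: sub_adherent; exists u.
have nX : inner (X n) w != 0.
  rewrite /n (linB lX) innerBl (Sclosed _ (proj_adherent GP v0)) subr0.
  exact/eqP.
have n0 : inner n n != 0.
  by rewrite dnorm_eq0; apply: contraNneq nX => ->; rewrite (lin0 lX) inner0l.
exists ((inner (X n) w / inner n n)^* *: n) => v.
(* This combination cancels the two values of the functional, so it lies in the kernel; its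
   orthogonality to [n] is the required formula. *)
have Sv : S (inner (X n) w *: v - inner (X v) w *: n).
  by rewrite /S /= (linB lX) !(linZ lX) innerBl !innerZl mulrC subrr.
have := proj_orthogonal GP v0 (sub_adherent Sv); rewrite -/n => nv.
have : inner (inner (X n) w *: v - inner (X v) w *: n) n = 0.
  by rewrite innerC nv conjC0.
rewrite innerBl !innerZl => /eqP; rewrite subr_eq0 => /eqP E.
by rewrite innerZr conjCK mulrAC E mulfK.
Qed.

(** * Passage between Hilbert space norms and squared norms *)

Section Hilbert.
Context {R : realType} {H : hilbertType R}.
Implicit Types (X Y : H -> H) (u v : H) (e : R[i]).

Lemma normE_sqnorm v : `|v| ^+ 2 = (sqnorm v)%:C%C.
Proof. by rewrite -inner_normE inner_sqnorm. Qed.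

Lemma gt0_complexE e : 0 < e -> exists2 r : R, 0 < r & e = r%:C%C.
Proof.
case: e => a b; rewrite ltcE /= => /andP[/eqP-> a0].
by exists a.
Qed.

Lemma norm_lt_sqnorm v (r : R) : 0 < r -> (`|v| < r%:C%C) = (sqnorm v < r ^+ 2).
Proof.
move=> r0; rewrite -ltcR -normE_sqnorm rmorphXn /=.
by rewrite ltr_pXn2r // ?nnegrE // ltW // ltcR.
Qed.

(** Multiplying [u] by the conjugate of [<u, v>] makes the inner product real, which reduces the
    complex Cauchy-Schwarz inequality to the real one. *)
Lemma inner_abs_sqr_le (K : preHilbertType R) (u v : K) :
  complex.Re (inner u v) ^+ 2 + complex.Im (inner u v) ^+ 2 <= sqnorm u * sqnorm v.
Proof.
set q := _ + _; have q0 : 0 <= q by rewrite addr_ge0 ?sqr_ge0.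
have := re_inner_sqr_le ((inner u v)^* *: u) v.
have -> : re_inner ((inner u v)^* *: u) v = q.
  by rewrite /re_inner innerZl /q; case: (inner u v) => a b /=; ring.
have -> : sqnorm ((inner u v)^* *: u) = q * sqnorm u.
  by rewrite sqnormZ /q; case: (inner u v) => a b /=; rewrite sqrrN.
have [->|qn0] := eqVneq q 0; first by rewrite mulr_ge0 ?sqnorm_ge0.
have qp : 0 < q by rewrite lt_def qn0.
by rewrite expr2 -mulrA ler_pM2l.
Qed.

Lemma norm_inner_lt u v (r : R) : 0 < r -> sqnorm u * sqnorm v < r ^+ 2 ->
  `|inner u v| < r%:C%C.
Proof.
move=> r0 uv; have := le_lt_trans (inner_abs_sqr_le u v) uv.
rewrite -ltcR add_Re2_Im2 rmorphXn /=.
by rewrite ltr_pXn2r // ?nnegrE // ltW // ltcR.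
Qed.

Lemma hilbert_complete : complete_inner H.
Proof.
move=> u uC; suff /cvg_ex[/= l ul] : cvg (u @ \oo).
  exists l => e e0; have s0 : 0 < Num.sqrt e by rewrite sqrtr_gt0.
  have /cvgrPdist_lt/(_ (Num.sqrt e)%:C%C) := ul; rewrite ltcR => /(_ s0).
  case=> N _ NP; exists N => n /NP /=.
  by rewrite norm_lt_sqnorm // sqr_sqrtr ?ltW // sqnormBC.
apply: cauchy_cvg; apply: cauchy_exP => e /gt0_complexE[r r0 ->].
have [N NP] := uC _ (exprn_gt0 2 r0); exists (u N); exists N => // n /= Nn.
by rewrite -ball_normE /ball_ /= norm_lt_sqnorm // NP.
Qed.

Lemma bounded_opP X : bounded_op X <-> bounded_linear X.
Proof.
split=> -[lX [k Xk]]; split=> //.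
  (* In [bounded_op] the constant is an arbitrary complex number, so its squared modulus serves as
     the real bound. *)
  exists (complex.Re k ^+ 2 + complex.Im k ^+ 2); split.
    by rewrite addr_ge0 ?sqr_ge0.
  move=> v; rewrite -lecR rmorphM /= add_Re2_Im2 -!normE_sqnorm -exprMn.
  rewrite ler_pXn2r // ?nnegrE // ?mulr_ge0 //; apply: le_trans (Xk v) _.
  have kv : 0 <= k * `|v| := le_trans (normr_ge0 _) (Xk v).
  by rewrite -[k * _]ger0_norm // normrM normr_id.
have [k0 kX] := Xk; exists (Num.sqrt k)%:C%C => v.
have s0 : 0 <= (Num.sqrt k)%:C%C :> R[i] by rewrite ler0c sqrtr_ge0.
rewrite -(@ler_pXn2r _ 2) // ?nnegrE // ?mulr_ge0 //.
rewrite exprMn !normE_sqnorm -rmorphXn /= sqr_sqrtr // -rmorphM /= lecR.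
exact: kX.
Qed.

Lemma adjointP X : bounded_op X -> is_adjoint X (adjoint X).
Proof.
move=> /bounded_opP Xb; have [Y XY] := riesz hilbert_complete Xb.
by rewrite (adjoint_eq XY).
Qed.

Lemma adjoint_bounded X : bounded_op X -> bounded_op (adjoint X).
Proof.
move=> Xb; have XX := adjointP Xb; apply/bounded_opP; split.
  exact: is_adjoint_linear XX.
exact: is_adjoint_bounded XX ((bounded_opP X).1 Xb).2.
Qed.

Lemma adjointK X : bounded_op X -> adjoint (adjoint X) = X.
Proof. by move=> Xb; apply/adjoint_eq/is_adjointC/adjointP. Qed.

End Hilbert.

(** * The bicommutant theorem *)

Section FiniteSum.
Context {R : realType} {I : finType} {H : preHilbertType R}.
Implicit Types u v : {ffun I -> H}.

Lemma inner_ffunE u v : inner u v = \sum_i inner (u i) (v i).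
Proof. by []. Qed.

Lemma sqnorm_ffun u : sqnorm u = \sum_i sqnorm (u i).
Proof.
apply: (@complexI R); rewrite -inner_sqnorm inner_ffunE rmorph_sum /=.
by apply: eq_bigr => i _; rewrite inner_sqnorm.
Qed.

Lemma sqnorm_ffun_ge u i : sqnorm (u i) <= sqnorm u.
Proof.
rewrite sqnorm_ffun (bigD1 i) //= lerDl.
by apply: sumr_ge0 => j _; exact: sqnorm_ge0.
Qed.

Lemma ffun_complete : complete_inner H -> complete_inner {ffun I -> H}.
Proof.
move=> Hc u uC.
have /choice[l lP] : forall i, exists l, forall e : R, 0 < e ->
    exists N, forall n, (N <= n)%N -> sqnorm (u n i - l) < e.
  move=> i; apply: Hc => e /uC[N NP]; exists N => m n Nm Nn.
  apply: le_lt_trans (NP _ _ Nm Nn).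
  by have := sqnorm_ffun_ge (u m - u n) i; rewrite !ffunE.
exists [ffun i => l i] => e e0.
have c0 : 0 < #|I|%:R + 1 :> R by rewrite ltr_wpDl.
have /choice[N NP] : forall i, exists N, forall n, (N <= n)%N ->
    sqnorm (u n i - l i) < e / (#|I|%:R + 1).
  by move=> i; apply: lP; rewrite divr_gt0.
exists (\max_i N i)%N => n Nn; rewrite sqnorm_ffun.
apply: (@le_lt_trans _ _ (\sum_(i : I) e / (#|I|%:R + 1))).
  apply: ler_sum => i _; rewrite !ffunE; apply/ltW/NP.
  by apply: leq_trans Nn; exact: leq_bigmax.
rewrite sumr_const -[ltLHS]mulr_natr mulrAC ltr_pdivrMr //.
by rewrite mulrDr mulr1 ltrDl.
Qed.

Definition amplify (X : H -> H) u : {ffun I -> H} := [ffun i => X (u i)].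

Lemma amplify_bounded X : bounded_linear X -> bounded_linear (amplify X).
Proof.
move=> [lX [k [k0 Xk]]]; split.
  by move=> c u v; apply/ffunP => i; rewrite !ffunE lX.
exists k; split=> // v; rewrite !sqnorm_ffun mulr_sumr.
by apply: ler_sum => i _; rewrite ffunE.
Qed.

Lemma amplify_adjoint X Y : is_adjoint X Y -> is_adjoint (amplify X) (amplify Y).
Proof.
by move=> XY u v; rewrite !inner_ffunE; apply: eq_bigr => i _; rewrite !ffunE.
Qed.

Definition single (i : I) (v : H) : {ffun I -> H} :=
  [ffun j => if j == i then v else 0].

Lemma amplify_single X i (v : H) : linear X -> amplify X (single i v) = single i (X v).
Proof.
by move=> lX; apply/ffunP => j; rewrite !ffunE; case: eqP => // _; rewrite lin0.
Qed.

Lemma single_linear i : linear (single i).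
Proof.
move=> c u v; apply/ffunP => j; rewrite !ffunE.
by case: eqP => // _; rewrite scaler0 addr0.
Qed.

Lemma sqnorm_single i (v : H) : sqnorm (single i v) = sqnorm v.
Proof.
rewrite sqnorm_ffun (bigD1 i) //= ffunE eqxx big1 ?addr0 // => j ji.
by rewrite ffunE (negbTE ji) sqnorm0.
Qed.

Lemma sum_single u : u = \sum_i single i (u i).
Proof.
apply/ffunP => j; rewrite sum_ffunE (bigD1 j) //= ffunE eqxx big1 ?addr0 //.
by move=> i ij; rewrite ffunE eq_sym (negbTE ij).
Qed.

End FiniteSum.

(** * Commutants of self-adjoint sets of operators *)

Section Commutants.
Context {R : realType} {H : hilbertType R}.
Implicit Types (A M : set (H -> H)) (X Y Z : H -> H).

Lemma bounded_op_lin X : bounded_op X -> linear X. Proof. by case. Qed.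

Lemma bounded_op_id : bounded_op (@idfun H).
Proof. by apply/bounded_opP; split=> //; exists 1; split=> // v; rewrite mul1r. Qed.

Lemma bounded_op0 : bounded_op (0 : H -> H).
Proof.
have zE v : (0 : H -> H) v = 0 by [].
apply/bounded_opP; split=> [c u v|]; first by rewrite !zE scaler0 addr0.
by exists 0; split=> // v; rewrite zE sqnorm0 mul0r.
Qed.

Lemma bounded_opZ (c : R[i]) X : bounded_op X -> bounded_op (c *: X).
Proof.
have sE v : (c *: X) v = c *: X v by [].
move=> /bounded_opP[lX [k [k0 Xk]]]; apply/bounded_opP; split.
  by move=> a u v; rewrite !sE lX scalerDr !scalerA (mulrC c).
exists ((complex.Re c ^+ 2 + complex.Im c ^+ 2) * k).
have c0 : 0 <= complex.Re c ^+ 2 + complex.Im c ^+ 2 by rewrite addr_ge0 ?sqr_ge0.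
split=> [|v]; first exact: mulr_ge0.
by rewrite -mulrA sE sqnormZ ler_wpM2l.
Qed.

Lemma bounded_opD X Y : bounded_op X -> bounded_op Y -> bounded_op (X + Y).
Proof.
move=> /bounded_opP[lX [k [k0 Xk]]] /bounded_opP[lY [l [l0 Yl]]].
apply/bounded_opP; split.
  by move=> a u v; rewrite !fctE /= lX lY scalerDr addrACA.
exists (2 * k + 2 * l); split=> [|v]; first lra.
rewrite !fctE /=; apply: le_trans (sqnormD_le _ _) _.
have := Xk v; have := Yl v; lra.
Qed.

Lemma bounded_op_comp X Y : bounded_op X -> bounded_op Y -> bounded_op (X \o Y).
Proof.
move=> /bounded_opP[lX [k [k0 Xk]]] /bounded_opP[lY [l [l0 Yl]]].
apply/bounded_opP; split; first by move=> a u v /=; rewrite lY lX.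
exists (k * l); split=> [|v]; first exact: mulr_ge0.
by rewrite -mulrA; apply: le_trans (Xk _) _; rewrite ler_wpM2l.
Qed.

Definition self_adjoint_set A :=
  (forall X, A X -> bounded_op X) /\ (forall X, A X -> A (adjoint X)).

Lemma commutant_app A X Y : commutant A X -> A Y -> forall v, X (Y v) = Y (X v).
Proof. by move=> [_ XA] /XA XY v; have := congr1 (fun f => f v) XY. Qed.

Lemma commutantI A X : bounded_op X ->
  (forall Y, A Y -> forall v, X (Y v) = Y (X v)) -> commutant A X.
Proof. by move=> Xb XA; split=> // Y AY; apply/funext => v /=; exact: XA. Qed.

Lemma commutant_adjoint A X : self_adjoint_set A -> commutant A X ->
  commutant A (adjoint X).
Proof.
move=> [Ab Aa] XA; have Xb := XA.1; apply: commutantI; first exact: adjoint_bounded.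
move=> Y AY v; apply: inner_ext => w.
have Xa := is_adjointC (adjointP Xb); have Ya := adjointP (Ab _ AY).
by rewrite Xa Ya -(commutant_app XA (Aa _ AY)) -Xa -Ya.
Qed.

Lemma commutant_id A : commutant A idfun.
Proof. by apply: commutantI => //; exact: bounded_op_id. Qed.

Lemma commutant_comp A X Y : commutant A X -> commutant A Y -> commutant A (X \o Y).
Proof.
move=> XA YA; apply: commutantI => [|Z AZ v /=].
  exact: bounded_op_comp XA.1 YA.1.
by rewrite (commutant_app YA AZ) (commutant_app XA AZ).
Qed.

Lemma commutantD A X Y : (forall Z, A Z -> bounded_op Z) ->
  commutant A X -> commutant A Y -> commutant A (X + Y).
Proof.
move=> Ab XA YA; apply: commutantI => [|Z AZ v /=].
  exact: bounded_opD XA.1 YA.1.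
rewrite !fctE (linD (bounded_op_lin (Ab _ AZ))).
by rewrite (commutant_app YA AZ) (commutant_app XA AZ).
Qed.

Lemma commutantZ A c X : (forall Z, A Z -> bounded_op Z) ->
  commutant A X -> commutant A (c *: X).
Proof.
have sE v : (c *: X) v = c *: X v by [].
move=> Ab XA; apply: commutantI => [|Z AZ v /=]; first exact: bounded_opZ XA.1.
rewrite sE (linZ (bounded_op_lin (Ab _ AZ))).
by rewrite (commutant_app XA AZ).
Qed.

Lemma self_adjoint_commutant A : self_adjoint_set A -> self_adjoint_set (commutant A).
Proof. by move=> As; split=> [X []|X] //; exact: commutant_adjoint. Qed.

Lemma commutant_wot_closed A : self_adjoint_set A -> wot_closed (commutant A).
Proof.
move=> [Ab Aa] X Xb XA; apply: commutantI => // Y AY v; apply: inner_ext => w.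
apply/eqP; rewrite -subr_eq0 -normr_le0; apply/ler_addgt0Pl => e.
case/gt0_complexE => r r0 ->; rewrite addr0.
have r2 : 0 < (r / 2)%:C%C :> R[i] by rewrite ltcR; lra.
(* The first pair tests [X Y]; the second tests [Y X] after moving [Y] to the other side of the
   inner product. *)
have [Z ZA ZX] := XA [:: (Y v, w); (v, adjoint Y w)] _ r2.
have := ZX (Y v, w); rewrite mem_head => /(_ isT) /= h1.
have := ZX (v, adjoint Y w); rewrite !inE eqxx orbT => /(_ isT) /= h2.
have Ya := adjointP (Ab _ AY).
have -> : inner (X (Y v)) w - inner (Y (X v)) w =
    inner ((X - Z) (Y v)) w - inner ((X - Z) v) (adjoint Y w).
  rewrite !fctE !innerBl -!Ya (commutant_app ZA AY).
  by rewrite opprB [RHS]addrA subrK.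
apply: le_trans (ler_normB _ _) _.
have -> : r%:C%C = (r / 2)%:C%C + (r / 2)%:C%C :> R[i].
  by rewrite -rmorphD /=; congr (_%:C%C); lra.
by apply: lerD; exact: ltW.
Qed.

Lemma commutant_von_neumann A : self_adjoint_set A -> von_neumann (commutant A).
Proof.
move=> As; have Ab := As.1; split; last exact: commutant_wot_closed.
split=> [X []||X Y|c X|] //.
- apply: commutantI; first exact: bounded_op0.
  by move=> Y AY v; rewrite (lin0 (bounded_op_lin (Ab _ AY))).
- exact: commutantD.
- exact: commutantZ.
- split; first exact: commutant_comp.
  by move=> X; exact: commutant_adjoint.
Qed.

Lemma commutant_nondegenerate A : nondegenerate_algebra (commutant A).
Proof.
apply/seteqP; split=> // v _; apply: subset_closure.
exists 1%N, (fun=> idfun), (fun=> v); split; first by move=> _; exact: commutant_id.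
by rewrite big_ord_recl big_ord0 addr0.
Qed.

Lemma von_neumann_self_adjoint M : von_neumann M -> self_adjoint_set M.
Proof. by case=> -[Mb _ _ _ [_ Ma]] _. Qed.

Lemma commutant_anti A B : A `<=` B -> commutant B `<=` commutant A.
Proof. by move=> AB X [Xb XB]; split=> // Y /AB; exact: XB. Qed.

Lemma sub_bicommutant A : (forall X, A X -> bounded_op X) ->
  A `<=` commutant (commutant A).
Proof.
move=> Ab X AX; apply: commutantI; first exact: Ab.
by move=> Y YA v; rewrite (commutant_app YA AX).
Qed.

Lemma tricommutant A : (forall X, A X -> bounded_op X) ->
  commutant (commutant (commutant A)) = commutant A.
Proof.
move=> Ab; apply/seteqP; split; first exact/commutant_anti/sub_bicommutant.
by apply: sub_bicommutant => X [].
Qed.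

End Commutants.

Section Bicommutant.
Context {R : realType} {H : hilbertType R}.
Implicit Types (A M S : set (H -> H)) (X Y Z : H -> H).

(** Since [<X w, v> = <w, X^* v> = 0], the vector is orthogonal to the dense span of the ranges of
    [M], hence to itself. *)
Lemma nondegenerate_separating M (v : H) : von_neumann M -> nondegenerate_algebra M ->
  (forall X, M X -> X v = 0) -> v = 0.
Proof.
move=> vM ndM Mv; have [Mb Ma] := von_neumann_self_adjoint vM.
apply: sqnorm_eq0; rewrite /sqnorm /re_inner.
set T := [set w | exists n (X : 'I_n -> H -> H) (w' : 'I_n -> H),
  (forall k, M (X k)) /\ w = \sum_k X k (w' k)] in ndM.
rewrite (@orthogonal_adherent _ _ T) // => [_ [n [X [w [MX ->]]]]|e e0].
  rewrite inner_sumr big1 // => k _.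
  by rewrite innerC (adjointP (Mb _ (MX k))) Mv ?inner0r ?conjC0 //; apply: Ma.
have s0 : 0 < Num.sqrt e by rewrite sqrtr_gt0.
have : closure T v by rewrite ndM.
move=> /(_ (ball v (Num.sqrt e)%:C%C)) [].
  by apply: nbhsx_ballx; rewrite ltcR.
move=> w [Tw]; rewrite -ball_normE /ball_ /= norm_lt_sqnorm // sqr_sqrtr ?ltW //.
by exists w.
Qed.

(* Amplification: the projection onto the closure of [M xi] in [H^n] is a matrix
   over the commutant of [M], so it commutes with the [n]-fold copy of [X]. *)
Lemma bicommutant_approx M X (n : nat) (xi : {ffun 'I_n -> H}) (e : R) :
  von_neumann M -> nondegenerate_algebra M -> commutant (commutant M) X -> 0 < e ->
  exists2 Y, M Y & forall i, sqnorm (X (xi i) - Y (xi i)) < e.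
Proof.
move=> vM ndM XM e0; have [Mb Ma] := von_neumann_self_adjoint vM.
have [[_ M0 MD MZ [MM _]] _] := vM.
pose L := [set amplify Y xi | Y in M].
have sL : subspace L.
  split=> [|_ _ [Y MY <-] [Z MZ' <-]|c _ [Y MY <-]].
  - by exists 0 => //; apply/ffunP => i; rewrite !ffunE.
  - by exists (Y + Z); [exact: MD|apply/ffunP => i; rewrite !ffunE].
  - by exists (c *: Y); [exact: MZ|apply/ffunP => i; rewrite !ffunE].
have [G GP] := orthogonal_projection_exists (ffun_complete hilbert_complete) sL.
have lG := proj_linear sL GP.
have blin Y : bounded_op Y -> bounded_linear Y by move/bounded_opP.
have Linv Y : M Y -> forall l, L l -> adherent L (amplify Y l).
  move=> MY _ [Z MZ' <-]; apply: sub_adherent; exists (Y \o Z); first exact: MM.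
  by apply/ffunP => i; rewrite !ffunE.
have GM Y : M Y -> forall v, amplify Y (G v) = G (amplify Y v).
  move=> MY; apply: (proj_commute sL GP (Y := amplify (adjoint Y))).
  - exact/amplify_bounded/blin/Mb.
  - exact/amplify_adjoint/adjointP/Mb.
  - exact: Linv.
  - by apply: Linv; exact: Ma.
(* The unit is not among the assumptions on [M], so this is not immediate. Every amplified element
   of [M] kills [xi - G xi], and nondegeneracy forces each coordinate to be zero. *)
have Gxi : G xi = xi.
  apply/eqP; rewrite eq_sym -subr_eq0; apply/eqP/ffunP => i; rewrite [RHS]ffunE.
  apply: (nondegenerate_separating vM ndM) => Y MY.
  have := linB (amplify_bounded (blin _ (Mb _ MY))).1 xi (G xi).
  rewrite (GM _ MY) (proj_id sL GP (v := amplify Y xi)) ?subrr; last first.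
    by apply: sub_adherent; exists Y.
  by move=> /(congr1 (fun u : {ffun 'I_n -> H} => u i)); rewrite !ffunE.
pose g i j (v : H) := G (single j v) i.
have gM i j : commutant M (g i j).
  apply: commutantI.
    apply/bounded_opP; split.
      by move=> c u v; rewrite /g single_linear lG !ffunE.
    exists 1; split=> // v; rewrite mul1r /g.
    apply: le_trans (sqnorm_ffun_ge _ i) _; apply: le_trans (proj_sqnorm_le sL GP _) _.
    by rewrite sqnorm_single.
  move=> Y MY v; rewrite /g -amplify_single; last by case: (Mb _ MY).
  by rewrite -GM // ffunE.
have Gg u i : G u i = \sum_j g i j (u j).
  by rewrite {1}(sum_single u) (linS lG) sum_ffunE.
have GX : amplify X xi = G (amplify X xi).
  rewrite -{1}Gxi; apply/ffunP => i; rewrite !ffunE !Gg (linS (bounded_op_lin XM.1)).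
  by apply: eq_bigr => j _; rewrite ffunE (commutant_app XM (gM i j)).
have : adherent L (amplify X xi) by rewrite GX; exact: proj_adherent GP _.
move=> /(_ _ e0)[_ [Y MY <-] XY]; exists Y => // i.
apply: le_lt_trans XY; have := sqnorm_ffun_ge (amplify X xi - amplify Y xi) i.
by rewrite !ffunE.
Qed.

Lemma bicommutant M : von_neumann M -> nondegenerate_algebra M ->
  commutant (commutant M) = M.
Proof.
move=> vM ndM; apply/seteqP; split; last first.
  by apply: sub_bicommutant; case: (von_neumann_self_adjoint vM).
move=> X XM; have [_ Mclosed] := vM; apply: Mclosed; first exact: XM.1.
move=> s _ /gt0_complexE[r r0 ->].
pose xi : {ffun 'I_(size s) -> H} := [ffun i : 'I_(size s) => (nth (0, 0) s i).1].
(* [C] dominates the squared norm of every second component in [s], so approximation on the first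
   components within [r^2 / C] controls all the matrix coefficients. *)
pose C := \sum_(i < size s) sqnorm (nth (0, 0) s i).2 + 1.
have C0 : 0 < C by rewrite ltr_wpDl // sumr_ge0 // => i _; exact: sqnorm_ge0.
have rC : 0 < r ^+ 2 / C by rewrite divr_gt0 // exprn_gt0.
have [Y MY XY] := bicommutant_approx xi vM ndM XM rC.
exists Y => // p /(nthP (0, 0))[k ks <-]; pose i := Ordinal ks.
apply: norm_inner_lt => //.
have := XY i; rewrite !ffunE ltr_pdivlMr //= => XYi.
apply: le_lt_trans XYi; apply: ler_wpM2l; first exact: sqnorm_ge0.
rewrite /C (bigD1 i) //= -addrA lerDl addr_ge0 // sumr_ge0 // => j _.
exact: sqnorm_ge0.
Qed.

Definition with_adjoints S : set (H -> H) := S `|` (@adjoint R H H) @` S.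

Lemma with_adjoints_self_adjoint S : (forall X, S X -> bounded_op X) ->
  self_adjoint_set (with_adjoints S).
Proof.
move=> Sb; split=> [X [/Sb //|[Y /Sb Yb <-]]|X [SX|[Y SY <-]]].
- exact: adjoint_bounded.
- by right; exists X.
- by left; rewrite adjointK //; exact: Sb.
Qed.

(** The bicommutant is itself one of the algebras being intersected; conversely any competing
    algebra contains the adjoints of [S] and equals its own bicommutant. *)
Lemma generated_bicommutant S : (forall X, S X -> bounded_op X) ->
  generated_von_neumann S = commutant (commutant (with_adjoints S)).
Proof.
move=> Sb; have As := with_adjoints_self_adjoint Sb; apply/seteqP; split=> X.
  apply.
  - exact/commutant_von_neumann/self_adjoint_commutant.
  - exact: commutant_nondegenerate.
  - by move=> Y SY; apply: (sub_bicommutant As.1); left.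
move=> XA M vM ndM SM; rewrite -(bicommutant vM ndM); move: X XA.
apply/commutant_anti/commutant_anti => Y [/SM //|[Z /SM MZ <-]].
by have [_] := von_neumann_self_adjoint vM; apply.
Qed.

Lemma commutant_generated S : (forall X, S X -> bounded_op X) ->
  commutant (generated_von_neumann S) = commutant (with_adjoints S).
Proof.
move=> Sb; rewrite generated_bicommutant // tricommutant //.
by case: (with_adjoints_self_adjoint Sb).
Qed.

End Bicommutant.

(** * Extension by continuity *)

Section Extension.
Context {R : realType} {H K : preHilbertType R}.
Variables (D : set (H * K)) (k : R) (G : H -> H).
Hypotheses (D0 : D (0, 0))
  (DD : forall p q, D p -> D q -> D (p.1 + q.1, p.2 + q.2))
  (DZ : forall (c : R[i]) p, D p -> D (c *: p.1, c *: p.2))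
  (k0 : 0 <= k) (Dk : forall p, D p -> sqnorm p.2 <= k * sqnorm p.1).

Lemma subspace_fst : subspace (fst @` D).
Proof.
split=> [|_ _ [p Dp <-] [q Dq <-]|c _ [p Dp <-]]; first by exists (0, 0).
- by exists (p.1 + q.1, p.2 + q.2) => //; exact: DD.
- by exists (c *: p.1, c *: p.2) => //; exact: DZ.
Qed.

(** Membership in the closure of the graph. [D] is a relation and not a function because an
    assignment such as [n psi |-> n (Z psi)] becomes well defined only through the bound on [D]. *)
Let limit_pair v w := forall e : R, 0 < e ->
  exists p, [/\ D p, sqnorm (v - p.1) < e & sqnorm (w - p.2) < e].

Let limit_pair_comb c v w v' w' : limit_pair v w -> limit_pair v' w' ->
  limit_pair (c *: v + v') (c *: w + w').
Proof.
move=> vw vw' e e0; pose a := complex.Re c ^+ 2 + complex.Im c ^+ 2.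
have a0 : 0 <= a by rewrite addr_ge0 ?sqr_ge0.
have m0 : 0 < 2 * a + 2 by lra.
have em : 0 < e / (2 * a + 2) by rewrite divr_gt0.
have [p [Dp]] := vw _ em; rewrite !ltr_pdivlMr // => vp wp.
have [q [Dq]] := vw' _ em; rewrite !ltr_pdivlMr // => vq wq.
exists (c *: p.1 + q.1, c *: p.2 + q.2); split=> /=.
- by apply: (DD (p := (c *: p.1, c *: p.2))) => //; exact: DZ.
- rewrite opprD addrACA -scalerBr; apply: le_lt_trans (sqnormD_le _ _) _.
  rewrite sqnormZ -/a; have := sqnorm_ge0 (v - p.1); have := sqnorm_ge0 (v' - q.1).
  nra.
- rewrite opprD addrACA -scalerBr; apply: le_lt_trans (sqnormD_le _ _) _.
  rewrite sqnormZ -/a; have := sqnorm_ge0 (w - p.2); have := sqnorm_ge0 (w' - q.2).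
  nra.
Qed.

(** The factor 4 comes from two uses of [|a + b|^2 <= 2 |a|^2 + 2 |b|^2]; it is harmless because
    only boundedness and uniqueness are drawn from it. *)
Let limit_pair_bound v w : limit_pair v w -> sqnorm w <= 4 * k * sqnorm v.
Proof.
move=> vw; apply/ler_addgt0Pl => e e0; have m0 : 0 < 4 * k + 2 by have := k0; lra.
pose e' := e / (4 * k + 2); have ee' : (4 * k + 2) * e' = e by rewrite mulrC divfK ?gt_eqF.
have [p [Dp vp wp]] := vw _ (divr_gt0 e0 m0); rewrite -/e' in vp wp; clearbody e'.
have pk := Dk Dp; have := sqnormD_le (w - p.2) p.2; rewrite subrK.
have := sqnormD_le (p.1 - v) v; rewrite subrK (sqnormBC p.1) => pv pw.
have : k * sqnorm p.1 <= k * (2 * e' + 2 * sqnorm v) by rewrite ler_wpM2l //; lra.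
nra.
Qed.

Let limit_pair_unique v w w' : limit_pair v w -> limit_pair v w' -> w = w'.
Proof.
move=> vw vw'; apply/eqP; rewrite -subr_eq0; apply/eqP/sqnorm_eq0/eqP.
rewrite eq_le sqnorm_ge0 andbT.
have := limit_pair_bound (limit_pair_comb (-1) vw' vw).
by rewrite !scaleN1r addNr sqnorm0 mulr0 addrC.
Qed.

Let limit_pair_exists v : complete_inner K -> adherent (fst @` D) v ->
  exists w, limit_pair v w.
Proof.
move=> Kc vD.
have /choice[p pP] : forall n : nat, exists p, D p /\ sqnorm (v - p.1) < n.+1%:R^-1.
  move=> n; have n0 : 0 < n.+1%:R^-1 :> R by rewrite invr_gt0 ltr0n.
  by have [_ [p Dp <-] vp] := vD _ n0; exists p.
have [|w wP] := Kc (fun n => (p n).2).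
  move=> e e0; have m0 : 0 < 4 * k + 1 by have := k0; lra.
  have [N NP] := invS_small (divr_gt0 e0 m0); exists N => m n Nm Nn.
  have [Dm vm] := pP m; have [Dn vn] := pP n.
  have := Dk (DD Dm (DZ (-1) Dn)); rewrite /= !scaleN1r => mn.
  have tri := sqnorm_tri v (p m).1 (p n).1; rewrite !(sqnormBC _ v) in tri.
  have := ler_wpM2l k0 tri.
  have := lt_trans vm (NP _ Nm); have := lt_trans vn (NP _ Nn).
  rewrite !ltr_pdivlMr //.
  have := sqnorm_ge0 (v - (p m).1); have := sqnorm_ge0 (v - (p n).1).
  nra.
exists w => e e0; have [N NP] := wP _ e0; have [N' NP'] := invS_small e0.
pose n := maxn N N'; exists (p n); have [Dn vn] := pP n; split=> //.
  exact: lt_trans vn (NP' _ (leq_maxr _ _)).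
by rewrite sqnormBC; exact: NP (leq_maxl _ _).
Qed.

(** The extension is evaluated at [G v], so it is defined everywhere and vanishes on the orthogonal
    complement of the domain. *)
Lemma bounded_extension : complete_inner K ->
  is_orthogonal_projection (fst @` D) G ->
  exists u : H -> K, [/\ bounded_linear u, forall p, D p -> u p.1 = p.2,
    forall v, u (G v) = u v & forall v, adherent (snd @` D) (u v)].
Proof.
move=> Kc GP; have sS := subspace_fst.
have /choice[u uP] : forall v, exists w, limit_pair (G v) w.
  by move=> v; apply: limit_pair_exists => //; exact: proj_adherent GP v.
exists u; split.
- split.
    move=> c v v'; apply: (limit_pair_unique (uP _)).
    rewrite (proj_linear sS GP); exact: limit_pair_comb.
  exists (4 * k); split=> [|v]; first by rewrite mulr_ge0.
  apply: le_trans (limit_pair_bound (uP v)) _.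
  by rewrite ler_wpM2l ?(proj_sqnorm_le sS GP) // mulr_ge0.
- move=> p Dp; apply: (limit_pair_unique (uP _)) => e e0.
  exists p; rewrite (proj_id sS GP) ?subrr ?sqnorm0; first by split.
  by apply: sub_adherent; exists p.
- move=> v; apply: (limit_pair_unique (uP _)); rewrite (projK sS GP); exact: uP.
- move=> v e /(uP v)[p [Dp _ ?]]; exists p.2 => //; by exists p.
Qed.

End Extension.

(** * Partial isometries from inner-product-preserving relations *)

Section PartialIsometry.
Context {R : realType} {H K : preHilbertType R}.
Variables (D : set (H * K)) (G : H -> H) (F : K -> K).
Hypotheses (D0 : D (0, 0))
  (DD : forall p q, D p -> D q -> D (p.1 + q.1, p.2 + q.2))
  (DZ : forall (c : R[i]) p, D p -> D (c *: p.1, c *: p.2))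
  (Diso : forall p q, D p -> D q -> inner p.1 q.1 = inner p.2 q.2)
  (Hc : complete_inner H) (Kc : complete_inner K)
  (GP : is_orthogonal_projection (fst @` D) G)
  (FP : is_orthogonal_projection (snd @` D) F).

(** A partial isometry and its adjoint, with initial projection [G] and final projection [F].
    Working on the whole Hilbert spaces postpones the passage to ranges to the very end. *)
Definition partial_isometry_pair (u : H -> K) (u' : K -> H) :=
  [/\ bounded_linear u, bounded_linear u', is_adjoint u u',
    forall v, u' (u v) = G v & forall w, u (u' w) = F w].

(** [D] and its converse are both extended. That the two extensions are adjoint follows by comparing
    the second with the Riesz adjoint of the first on the range of [D]. *)
Lemma partial_isometry_extension : exists u u',
  partial_isometry_pair u u' /\ forall p, D p -> u p.1 = p.2 /\ u' p.2 = p.1.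
Proof.
pose D' := [set (p.2, p.1) | p in D].
have D'1 : fst @` D' = snd @` D.
  by apply/seteqP; split=> [_ [_ [p Dp <-] <-]|_ [p Dp <-]];
    [exists p|exists (p.2, p.1) => //; exists p].
have D'2 : snd @` D' = fst @` D.
  by apply/seteqP; split=> [_ [_ [p Dp <-] <-]|_ [p Dp <-]];
    [exists p|exists (p.2, p.1) => //; exists p].
have [] := @bounded_extension _ _ _ D 1 G D0 DD DZ ler01 _ Kc GP.
  by move=> p Dp; rewrite mul1r /sqnorm /re_inner (Diso Dp Dp).
move=> u [ub uD uG ua].
have [|||||u'] := @bounded_extension _ _ _ D' 1 F _ _ _ ler01 _ Hc; rewrite ?D'1 ?D'2 //.
- by exists (0, 0).
- move=> _ _ [p Dp <-] [q Dq <-] /=; exists (p.1 + q.1, p.2 + q.2) => //; exact: DD.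
- move=> c _ [p Dp <-] /=; exists (c *: p.1, c *: p.2) => //; exact: DZ.
- by move=> _ [p Dp <-]; rewrite mul1r /sqnorm /re_inner (Diso Dp Dp).
move=> [u'b u'D u'F u'a].
have {}u'D p : D p -> u' p.2 = p.1 by move=> Dp; apply: (u'D (p.2, p.1)); exists p.
have sG := subspace_fst D0 DD DZ.
have sF : subspace (snd @` D).
  split=> [|_ _ [p Dp <-] [q Dq <-]|c _ [p Dp <-]]; first by exists (0, 0).
  - by exists (p.1 + q.1, p.2 + q.2) => //; exact: DD.
  - by exists (c *: p.1, c *: p.2) => //; exact: DZ.
have comp_bounded (L1 L2 L3 : preHilbertType R) (X : L2 -> L3) (Y : L1 -> L2) :
    bounded_linear X -> bounded_linear Y -> bounded_linear (X \o Y).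
  move=> [lX [a [a0 Xa]]] [lY [b [b0 Yb]]]; split; first by move=> c v w /=; rewrite lY lX.
  exists (a * b); split=> [|v]; first exact: mulr_ge0.
  by rewrite -mulrA; apply: le_trans (Xa _) _; rewrite ler_wpM2l.
have id_bounded (L : preHilbertType R) : bounded_linear (@idfun L).
  by split=> //; exists 1; split=> // v; rewrite mul1r.
have u'u v : u' (u v) = G v.
  rewrite -uG; apply: (bounded_eq_adherent (comp_bounded _ _ _ _ _ u'b ub) (id_bounded _)
    _ (proj_adherent GP v)) => _ [p Dp <-] /=.
  by rewrite uD ?u'D.
have uu' v : u (u' v) = F v.
  rewrite -u'F; apply: (bounded_eq_adherent (comp_bounded _ _ _ _ _ ub u'b) (id_bounded _)
    _ (proj_adherent FP v)) => _ [p Dp <-] /=.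
  by rewrite u'D ?uD.
exists u, u'; split; last by move=> p Dp; rewrite uD ?u'D.
split=> //.
have [u1 u1P] := riesz Hc ub.
have u1b : bounded_linear u1.
  by split; [exact: is_adjoint_linear u1P|exact: is_adjoint_bounded u1P ub.2].
have u1D w : (snd @` D) w -> u1 w = u' w.
  move=> [q Dq <-]; apply/eqP; rewrite -subr_eq0; apply/eqP/inner_ext => v.
  rewrite inner0l -[RHS]conjC0 innerC; congr (_^*).
  have -> : inner v (u1 q.2 - u' q.2) = inner (G v) (u1 q.2 - u' q.2).
    rewrite !innerBr -!u1P uG; congr (_ - _).
    by rewrite (proj_adjoint GP) (proj_id sG GP (u'a q.2)).
  rewrite innerC -[RHS]conjC0; congr (_^*).
  apply: orthogonal_adherent (proj_adherent GP v) => _ [p Dp <-].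
  by rewrite innerC innerBr -u1P uD // u'D // (Diso Dp Dq) subrr conjC0.
move=> v w; rewrite -(proj_id sF FP (ua v)) (proj_adjoint FP) u1P.
rewrite (bounded_eq_adherent u1b u'b u1D (proj_adherent FP w)).
by rewrite u'F.
Qed.

End PartialIsometry.

Lemma conj_real_complex (R : realType) (t : R) : (t%:C%C)^* = t%:C%C :> R[i].
Proof. by apply: conj_Creal; apply/complex_realP; exists t. Qed.

(** * Lifting operators from a corner *)

(** Convexity makes the increments nondecreasing, so a positive first increment would force at least
    linear growth. *)
Lemma convex_bounded_nonincreasing (R : realType) (h : nat -> R) (C : R) :
  (forall m, 2 * h m.+1 <= h m + h m.+2) -> (forall m, h m <= C) -> h 1%N <= h 0%N.
Proof.
move=> hconv hC; rewrite leNgt; apply/negP => h01.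
pose t := h 1%N - h 0%N; have t0 : 0 < t by rewrite subr_gt0.
have step m : t <= h m.+1 - h m.
  elim: m => [//|m IH]; have := hconv m; lra.
have growth m : h 0%N + t * m%:R <= h m.
  elim: m => [|m IH]; first by rewrite mulr0 addr0.
  have := step m; rewrite -natr1 mulrDr mulr1; lra.
pose m := (Num.truncn ((C - h 0%N) / t)).+1.
have := truncnS_gt ((C - h 0%N) / t); rewrite -/m ltr_pdivrMr // mulrC.
have := growth m; have := hC m; lra.
Qed.

Section CornerLift.
Context {R : realType} {H : hilbertType R}.
Variables (A : set (H -> H)) (psi : H) (G Z : H -> H).
Hypotheses (As : self_adjoint_set A) (GA : commutant A G) (GG : forall v, G (G v) = G v)
  (Ga : is_adjoint G G) (Gpsi : G psi = psi) (Zb : bounded_op Z)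
  (ZG : forall v, Z (G v) = Z v) (GZ : forall v, G (Z v) = Z v)
  (Zc : forall c, commutant A c -> (forall v, c v = G (c (G v))) ->
     forall v, Z (c v) = c (Z v)).

(* For [n'] in the commutant, [c = G n'^* n' G] commutes with [Z], hence with
   [B = Z^* Z]; so [m |-> |n' B^m psi|^2] is convex, and it is bounded once [B]
   is rescaled to be a contraction. *)
Lemma corner_bound : exists k : R, 0 <= k /\ forall n, commutant A n ->
  sqnorm (n (Z psi)) <= k * sqnorm (n psi).
Proof.
have [lZ [k [k0 Zk]]] := (bounded_opP Z).1 Zb.
have Zs := adjointP Zb; have lZs := is_adjoint_linear Zs.
have [_ [l [l0 Zsl]]] := (bounded_opP _).1 (adjoint_bounded Zb).
have q0 : 0 < k + l + 1 by lra.
(* [k] and [l] bound [Z] and its adjoint in squared norm and [k l <= q^2], so [Z^* Z] divided by [q]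
   is a contraction. *)
pose q := (k + l + 1); exists q; split=> [|n nA]; first exact: ltW.
have [ln [b [b0 nb]]] := (bounded_opP n).1 nA.1.
have na := adjointP nA.1; have nsA := commutant_adjoint As nA.
pose c v := G (adjoint n (n (G v))).
have cA : commutant A c.
  exact: commutant_comp GA (commutant_comp nsA (commutant_comp nA GA)).
have cG v : c v = G (c (G v)) by rewrite /c !GG.
have ca : is_adjoint c c.
  by move=> u v; rewrite /c Ga (is_adjointC na) na Ga.
have cZ := Zc cA cG.
have cZs v : adjoint Z (c v) = c (adjoint Z v).
  by apply: inner_ext => w; rewrite (is_adjointC Zs) !ca -cZ (is_adjointC Zs).
have GZs v : G (adjoint Z v) = adjoint Z v.
  by apply: inner_ext => w; rewrite Ga !(is_adjointC Zs) ZG.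
pose B v := (q^-1)%:C%C *: adjoint Z (Z v).
have GB v : G (B v) = B v.
  by rewrite /B (linZ (bounded_op_lin GA.1)) GZs.
have cn x y : G x = x -> G y = y -> inner (n x) (n y) = inner (c x) y.
  by move=> Gx Gy; rewrite /c Ga Gx Gy (is_adjointC na).
have Bsym x y : G x = x -> G y = y -> inner (n (B x)) (n y) = inner (n x) (n (B y)).
  move=> Gx Gy; rewrite !cn //; have lc := bounded_op_lin cA.1.
  rewrite /B (linZ lc) innerZl innerZr conj_real_complex -cZs -cZ.
  by rewrite (is_adjointC Zs) Zs.
have B1 v : sqnorm (B v) <= sqnorm v.
  rewrite sqnormZr exprVn mulrC ler_pdivrMr ?exprn_gt0 //.
  apply: le_trans (Zsl _) _; apply: le_trans (ler_wpM2l l0 (Zk v)) _.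
  rewrite mulrA (mulrC (sqnorm v)) ler_wpM2r ?sqnorm_ge0 // /q; nra.
pose x m := iter m B psi; have Gx m : G (x m) = x m by case: m => [|m] //; exact: GB.
pose h m := sqnorm (n (x m)).
have h10 : h 1%N <= h 0%N.
  (* [B] is symmetric for the form [<n x, n y>], so the pairing of [n (x m.+2)] with [n (x m)]
     equals [h m.+1], and convexity is [2 Re <a, b> <= |a|^2 + |b|^2]. *)
  apply: (@convex_bounded_nonincreasing _ h (b * sqnorm psi)) => m.
    have := re_inner_le (n (x m.+2)) (n (x m)).
    rewrite /re_inner [x m.+2]/(B (x m.+1)) Bsym // -/(x m.+1) -/(sqnorm _).
    rewrite addrC; exact.
  apply: le_trans (nb _) _; rewrite ler_wpM2l //.
  by elim: m => [//|m IH]; exact: le_trans (B1 _) IH.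
(* [|n Z psi|^2] becomes a pairing of [n B psi] with [n psi], at most [q (h 1 + h 0) / 2], hence at
   most [q h 0]. *)
have -> : sqnorm (n (Z psi)) = q * re_inner (n (x 1%N)) (n psi).
  rewrite -re_innerZl -(linZ ln) /x /= /B scalerA -rmorphM /= mulfV ?gt_eqF //.
  rewrite scale1r /sqnorm /re_inner !cn ?GZ ?GZs //.
  by rewrite -cZs (is_adjointC Zs).
rewrite ler_pM2l //; have := re_inner_le (n (x 1%N)) (n psi); move: h10.
by rewrite /h /=; lra.
Qed.

(** The lift is zero off the closure of [{n psi}]. This closure reduces every element of
    [commutant A], so commutation needs checking only on the vectors [n psi]. *)
Lemma corner_lift : exists Y, commutant (commutant A) Y /\
  forall n, commutant A n -> Y (n psi) = n (Z psi).
Proof.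
have [k [k0 kP]] := corner_bound.
pose D := [set (n psi, n (Z psi)) | n in commutant A].
have DD p q : D p -> D q -> D (p.1 + q.1, p.2 + q.2).
  move=> [n nA <-] [m mA <-]; exists (n + m) => //.
  by apply: commutantD => //; case: As.
have DZ (c : R[i]) p : D p -> D (c *: p.1, c *: p.2).
  move=> [n nA <-]; exists (c *: n) => //.
  by apply: commutantZ => //; case: As.
have D0 : D (0, 0).
  have [p Dp] : D !=set0 by exists (psi, Z psi); exists idfun => //; exact: commutant_id.
  by have := DZ 0 _ Dp; rewrite !scale0r.
have Dk p : D p -> sqnorm p.2 <= k * sqnorm p.1 by move=> [n nA <-]; exact: kP.
have sS := subspace_fst D0 DD DZ.
have [F FP] := orthogonal_projection_exists hilbert_complete sS.
have [Y [Yb YD YF _]] := bounded_extension D0 DD DZ k0 Dk hilbert_complete FP.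
have Yn n : commutant A n -> Y (n psi) = n (Z psi).
  by move=> nA; apply: (YD (n psi, n (Z psi))); exists n.
exists Y; split=> //; apply: commutantI => [|m mA v]; first exact/bounded_opP.
have mS n : commutant A n -> forall s, (fst @` D) s -> adherent (fst @` D) (n s).
  move=> nA _ [_ [n' n'A <-] <-]; apply: sub_adherent.
  exists ((n \o n') psi, (n \o n') (Z psi)) => //.
  by exists (n \o n') => //; exact: commutant_comp.
have mb := (bounded_opP m).1 mA.1.
have mF := proj_commute sS FP mb (adjointP mA.1) (mS _ mA) (mS _ (commutant_adjoint As mA)).
rewrite -YF -mF -[Y v]YF.
have Ym : bounded_linear (Y \o m) /\ bounded_linear (m \o Y).
  have Yo := (bounded_opP Y).2 Yb.
  by split; apply/bounded_opP; apply: bounded_op_comp => //; case: mA.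
apply: (bounded_eq_adherent Ym.1 Ym.2 _ (proj_adherent FP v)) => _ [_ [n nA <-] <-] /=.
by rewrite Yn // (Yn (m \o n)) //; exact: commutant_comp.
Qed.

End CornerLift.

(** * Moments of words *)

Section Moments.
Context {R : realType} {d : nat}.
Notation letter := ('I_d * bool)%type.
Variable alpha : 'I_d -> R.
Hypotheses (alpha_gt0 : forall i, 0 < alpha i) (alpha_lt1 : forall i, alpha i < 1).

(* The letter [(i, false)] stands for [r_i] and [(i, true)] for [r_i^*]; a word is
   read as a product of operators. *)
Definition weight (l : letter) : R :=
  if l.2 then alpha l.1 ^+ 2 else (alpha l.1 ^+ 2)^-1.

(** Stated for functions of words alone, so that protocols on different Hilbert spaces can be
    compared. *)
Definition moment_rules (f : seq letter -> R[i]) :=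
  [/\ f [::] = 1,
      forall l w, f (l :: w) = (weight l)%:C%C * f (rcons w l)
    & forall u i j v, f (u ++ (i, false) :: (j, true) :: v) =
        if i == j then f (u ++ v) else 0].

Lemma weight_gt0 l : 0 < weight l.
Proof. by rewrite /weight; case: ifP => _; rewrite ?invr_gt0 exprn_gt0. Qed.

Lemma word_cases (w : seq letter) :
  (exists u i j v, w = u ++ (i, false) :: (j, true) :: v) \/
  exists m n, w = [seq (i, true) | i <- m] ++ [seq (i, false) | i <- n].
Proof.
elim: w => [|[i b] w [[u [i' [j [v ->]]]]|[m [n ->]]]].
- by right; exists [::], [::].
- by left; exists ((i, b) :: u), i', j, v.
- case: b; first by right; exists (i :: m), n.
  case: m => [|j m]; first by right; exists [::], (i :: n).
  by left; exists [::], i, j, ([seq (k, true) | k <- m] ++ [seq (k, false) | k <- n]).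
Qed.

Lemma moment_rotate f u w : moment_rules f ->
  f (u ++ w) = (\prod_(l <- u) weight l)%:C%C * f (w ++ u).
Proof.
move=> [_ fr _]; elim: u w => [|l u IH] w; first by rewrite big_nil mul1r cats0.
rewrite big_cons rmorphM /= fr -mulrA; congr (_ * _).
by rewrite rcons_cat IH cat_rcons.
Qed.

(* Rotating a word with only [r_i]'s, or only [r_i^*]'s, once around multiplies its
   moment by a number different from [1]. *)
Lemma moment_one_sided f m b : moment_rules f -> m != [::] ->
  f [seq (i, b) | i <- m] = 0.
Proof.
move=> fP m0; have := moment_rotate [seq (i, b) | i <- m] [::] fP.
rewrite cats0 cat0s; set q := \prod_(_ <- _) _; set x := f _ => E.
suff q1 : q != 1.
  apply/eqP; move/eqP: E; rewrite -{1}[x]mul1r -subr_eq0 -mulrBl mulf_eq0.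
  by rewrite subr_eq0 eq_sym (_ : (1 : R[i]) = 1%:C%C) // (inj_eq (@complexI R)) (negbTE q1).
(* The strict bound is the one wanted; the weak bound, valid also for the empty list, carries the
   induction. *)
have small n : (n <> [::] -> \prod_(i <- n) alpha i ^+ 2 < 1) /\
    \prod_(i <- n) alpha i ^+ 2 <= 1.
  elim: n => [|i n [_ IH]]; first by rewrite big_nil.
  have lt1 : \prod_(j <- i :: n) alpha j ^+ 2 < 1.
    rewrite big_cons; apply: (@le_lt_trans _ _ (alpha i ^+ 2)).
      by rewrite ler_piMr // sqr_ge0.
    by rewrite expr_lt1 // ltW.
  by split=> //; exact: ltW.
have [/(_ (elimN eqP m0)) lt1 _] := small m.
have gt0 : 0 < \prod_(i <- m) alpha i ^+ 2.
  by apply: prodr_gt0 => i _; rewrite exprn_gt0.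
rewrite /q big_map /weight /=; case: b {q x E}; first by rewrite lt_eqF.
by rewrite prodfV gt_eqF // invf_gt1.
Qed.

(** Induction on length. In a word of adjoint letters followed by plain ones, both present, the
    rotation rule is used backwards: the last [r_j] comes to the front, meets the leading [r_i^*],
    and the word loses two letters. *)
Lemma moment_unique f g : moment_rules f -> moment_rules g -> f =1 g.
Proof.
move=> fP gP w; have [n] := ubnP (size w); elim: n w => // n IH w wn.
have [f1 fr fd] := fP; have [g1 gr gd] := gP.
have [[u [i [j [v E]]]]|[m [k E]]] := word_cases w.
  rewrite E fd gd; case: eqP => // _; apply: IH.
  by move: wn; rewrite E !size_cat /=; lia.
have [m0|m0] := eqVneq m [::].
  have [k0|k0] := eqVneq k [::]; first by rewrite E m0 k0 f1 g1.
  by rewrite E m0 !moment_one_sided.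
have [k0|k0] := eqVneq k [::].
  by rewrite E k0 cats0 !moment_one_sided.
case/lastP: k k0 E => [//|k j] _; case: m m0 => [//|i m] _ E.
have El : w = rcons ((i, true) :: [seq (l, true) | l <- m] ++ [seq (l, false) | l <- k])
  (j, false) by rewrite E map_rcons /= -rcons_cat.
have wj : (weight (j, false))%:C%C != 0 :> R[i].
  by rewrite (_ : 0 = 0%:C%C) // (inj_eq (@complexI R)) gt_eqF // weight_gt0.
apply: (mulfI wj); rewrite El -fr -gr.
rewrite -[_ :: _ :: _]cat0s fd gd; case: eqP => // _; apply: IH.
by move: wn; rewrite El size_rcons /=; lia.
Qed.

End Moments.

(** * Embezzlement protocols *)

Section Protocol.
Context {R : realType} {H : hilbertType R} {d : nat}.
Notation letter := ('I_d * bool)%type.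
Variables (alpha : 'I_d -> R) (r t : 'I_d -> H -> H) (psi : H).

(** The part of a protocol carried by column 0 of both block operators, in a form whose symmetry in
    [r] and [t] lets each consequence be used twice. *)
Definition embezzling_columns :=
  [/\ (forall i, bounded_op (r i)) /\ (forall j, bounded_op (t j)),
      (forall i j v, r i (t j v) = t j (r i v)) /\
      (forall i j v, r i (adjoint (t j) v) = adjoint (t j) (r i v)),
      (forall v, \sum_i sqnorm (r i v) <= sqnorm v) /\
      (forall v, \sum_i sqnorm (t i v) <= sqnorm v),
      sqnorm psi = 1
    & forall i j, r i (t j psi) = if i == j then (alpha i)%:C%C *: psi else 0].

End Protocol.

Lemma embezzling_columns_sym (R : realType) (H : hilbertType R) d (alpha : 'I_d -> R)
    (r t : 'I_d -> H -> H) psi :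
  embezzling_columns alpha r t psi -> embezzling_columns alpha t r psi.
Proof.
move=> [[rb tb] [rt rta] [rc tc] psi1 rtpsi]; split=> //.
- split=> i j v; first by rewrite rt.
  (* Commutation of [t_i] with [r_j^*] is the adjoint of commutation of [r_j] with [t_i^*]. *)
  apply: inner_ext => w; have ta := adjointP (tb i).
  have ra := is_adjointC (adjointP (rb j)).
  by rewrite ta ra rta -ta -ra.
- by move=> i j; rewrite -rt rtpsi eq_sym; case: eqP => // ->.
Qed.

Section ProtocolTheory.
Context {R : realType} {H : hilbertType R} {d : nat}.
Notation letter := ('I_d * bool)%type.
Variables (alpha : 'I_d -> R) (r t : 'I_d -> H -> H) (psi : H).
Hypotheses (alpha_gt0 : forall i, 0 < alpha i) (alpha_unit : \sum_i alpha i ^+ 2 = 1).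
Hypothesis (E : embezzling_columns alpha r t psi).

Lemma adjoint_column_le j v : sqnorm (adjoint (r j) v) <= sqnorm v.
Proof.
have [[rb _] _ [rc _] _ _] := E.
have r1 w : sqnorm (r j w) <= sqnorm w.
  apply: le_trans (rc w); rewrite (bigD1 j) //= lerDl.
  by apply: sumr_ge0 => i _; exact: sqnorm_ge0.
have Ej : sqnorm (adjoint (r j) v) = re_inner v (r j (adjoint (r j) v)).
  by rewrite /sqnorm /re_inner (is_adjointC (adjointP (rb j))).
have := re_inner_le v (r j (adjoint (r j) v)); have := r1 (adjoint (r j) v).
by rewrite -Ej; lra.
Qed.

(* The protocol sends a unit vector to a unit vector, so both contractions are
   isometric there; equality in the norm estimates forces this identity. *)
Lemma column_adjoint j : t j psi = (alpha j)%:C%C *: adjoint (r j) psi.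
Proof.
have [[rb _] _ [_ tc] psi1 rt] := E.
have term i : sqnorm (t i psi - (alpha i)%:C%C *: adjoint (r i) psi) =
    sqnorm (t i psi) - 2 * alpha i ^+ 2 + alpha i ^+ 2 * sqnorm (adjoint (r i) psi).
  rewrite sqnormB sqnormZr re_innerZr.
  have -> : re_inner (t i psi) (adjoint (r i) psi) = alpha i.
    rewrite /re_inner -(adjointP (rb i)) rt eqxx innerZl inner_sqnorm psi1.
    by rewrite mulr1.
  by ring.
(* The three parts of the expanded sum contribute at most 1, exactly -2 and at most 1. *)
have : \sum_i sqnorm (t i psi - (alpha i)%:C%C *: adjoint (r i) psi) <= 0.
  under eq_bigr do rewrite term.
  rewrite big_split /= sumrB -mulr_sumr alpha_unit.
  have h1 := tc psi; rewrite psi1 in h1.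
  have : \sum_i alpha i ^+ 2 * sqnorm (adjoint (r i) psi) <= 1.
    rewrite -alpha_unit; apply: ler_sum => i _.
    by rewrite ler_piMr ?sqr_ge0 // -psi1 adjoint_column_le.
  lra.
move=> le0; apply/eqP; rewrite -subr_eq0; apply/eqP/sqnorm_eq0/eqP.
rewrite eq_le sqnorm_ge0 andbT; apply: le_trans le0.
by rewrite (bigD1 j) //= lerDl sumr_ge0 // => i _; exact: sqnorm_ge0.
Qed.

Lemma adjoint_column j : adjoint (r j) psi = (alpha j)^-1%:C%C *: t j psi.
Proof.
rewrite column_adjoint scalerA -rmorphM /= mulVf ?gt_eqF //.
by rewrite scale1r.
Qed.

Lemma column_cuntz i j : r i (adjoint (r j) psi) = if i == j then psi else 0.
Proof.
have [[rb _] _ _ _ rt] := E.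
rewrite adjoint_column (linZ (bounded_op_lin (rb i))) rt.
case: eqP => [->|_]; last by rewrite scaler0.
by rewrite scalerA -rmorphM /= mulVf ?gt_eqF // scale1r.
Qed.

End ProtocolTheory.

(** * Words in the columns and their action on the vector state *)

Section Words.
Context {R : realType} {H : hilbertType R} {d : nat}.
Notation letter := ('I_d * bool)%type.
Implicit Types (r t : 'I_d -> H -> H) (l : letter) (w : seq letter).

Definition letter_op r l : H -> H := if l.2 then adjoint (r l.1) else r l.1.
Definition word_op r w (v : H) : H := foldr (letter_op r) v w.
Definition moment r (psi : H) w : R[i] := inner (word_op r w psi) psi.
Definition adjoint_word w : seq letter := rev [seq (l.1, ~~ l.2) | l <- w].
(** Formal combinations are kept as lists of coefficients and words, so that one list can be
    evaluated in two protocols; different lists may give the same vector. *)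
Definition word_sum r (psi : H) (p : seq (R[i] * seq letter)) : H :=
  \sum_(x <- p) x.1 *: word_op r x.2 psi.
Definition columns_with_adjoints r : set (H -> H) :=
  with_adjoints [set r i | i in [set: 'I_d]].

Variable r : 'I_d -> H -> H.
Hypothesis rb : forall i, bounded_op (r i).

Lemma letter_bounded l : bounded_op (letter_op r l).
Proof. by rewrite /letter_op; case: ifP => _ //; exact: adjoint_bounded. Qed.

Lemma letter_adjoint l : is_adjoint (letter_op r l) (letter_op r (l.1, ~~ l.2)).
Proof.
by case: l => i []; rewrite /letter_op /=; [apply: is_adjointC|]; exact: adjointP.
Qed.

Lemma word_op_cat u w v : word_op r (u ++ w) v = word_op r u (word_op r w v).
Proof. exact: foldr_cat. Qed.

Lemma word_bounded w : bounded_op (word_op r w).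
Proof.
elim: w => [|l w IH]; first exact: bounded_op_id.
exact: bounded_op_comp (letter_bounded l) IH.
Qed.

Lemma word_adjoint w : is_adjoint (word_op r w) (word_op r (adjoint_word w)).
Proof.
elim: w => [|l w IH] u v //.
rewrite /adjoint_word map_cons rev_cons -cats1 word_op_cat -IH.
exact: letter_adjoint.
Qed.

Lemma word_commute (X : H -> H) : (forall l v, X (letter_op r l v) = letter_op r l (X v)) ->
  forall w v, X (word_op r w v) = word_op r w (X v).
Proof. by move=> Xl; elim=> [|l w IH] v //=; rewrite Xl IH. Qed.

Lemma columns_with_adjointsP X : columns_with_adjoints r X <-> exists l, X = letter_op r l.
Proof.
split=> [[[i _ <-]|[_ [i _ <-] <-]]|[[i []] ->]].
- by exists (i, false).
- by exists (i, true).
- by right; exists (r i) => //; exists i.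
- by left; exists i.
Qed.

Lemma columns_self_adjoint : self_adjoint_set (columns_with_adjoints r).
Proof. by apply: with_adjoints_self_adjoint => _ [i _ <-]. Qed.

Lemma commutant_columns (X : H -> H) : bounded_op X ->
  (forall l v, X (letter_op r l v) = letter_op r l (X v)) ->
  commutant (columns_with_adjoints r) X.
Proof.
by move=> Xb Xl; apply: commutantI => // Y /columns_with_adjointsP[l ->]; exact: Xl.
Qed.

Lemma commutant_letter (X : H -> H) l v : commutant (columns_with_adjoints r) X ->
  X (letter_op r l v) = letter_op r l (X v).
Proof. by move=> XA; apply: commutant_app XA _ _; apply/columns_with_adjointsP; exists l. Qed.

Lemma commutant_word (X : H -> H) w v : commutant (columns_with_adjoints r) X ->
  X (word_op r w v) = word_op r w (X v).
Proof. by move=> XA; apply: word_commute => l u; exact: commutant_letter. Qed.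

Lemma inner_words psi w w' :
  inner (word_op r w psi) (word_op r w' psi) = moment r psi (adjoint_word w' ++ w).
Proof. by rewrite /moment word_op_cat (is_adjointC (word_adjoint w')). Qed.

Lemma word_sum_comb psi (c : R[i]) p q :
  word_sum r psi ([seq (c * x.1, x.2) | x <- p] ++ q) =
  c *: word_sum r psi p + word_sum r psi q.
Proof.
rewrite /word_sum big_cat big_map /= scaler_sumr; congr (_ + _).
by apply: eq_bigr => x _; rewrite scalerA.
Qed.

Lemma word_sum_nil psi : word_sum r psi [::] = 0.
Proof. by rewrite /word_sum big_nil. Qed.

Lemma word_sum_word psi w : word_sum r psi [:: (1, w)] = word_op r w psi.
Proof. by rewrite /word_sum big_seq1 scale1r. Qed.

Lemma word_sum_apply psi (X : H -> H) (f : R[i] * seq letter -> R[i] * seq letter) p :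
  linear X ->
  (forall x, x.1 *: X (word_op r x.2 psi) = (f x).1 *: word_op r (f x).2 psi) ->
  X (word_sum r psi p) = word_sum r psi (map f p).
Proof.
move=> lX Xf; rewrite /word_sum big_map (linS lX).
by apply: eq_bigr => x _; rewrite (linZ lX).
Qed.

Lemma word_sum_subspace psi : subspace (range (word_sum r psi)).
Proof.
split=> [|_ _ [p _ <-] [q _ <-]|c _ [p _ <-]].
- by exists [::] => //; exact: word_sum_nil.
- exists ([seq (1 * x.1, x.2) | x <- p] ++ q) => //.
  by rewrite word_sum_comb scale1r.
- exists ([seq (c * x.1, x.2) | x <- p] ++ [::]) => //.
  by rewrite word_sum_comb word_sum_nil addr0.
Qed.

End Words.

Section ProtocolSpace.
Context {R : realType} {H : hilbertType R} {d : nat}.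
Notation letter := ('I_d * bool)%type.
Variables (alpha : 'I_d -> R) (r t : 'I_d -> H -> H) (psi : H).
Hypotheses (alpha_gt0 : forall i, 0 < alpha i) (alpha_unit : \sum_i alpha i ^+ 2 = 1).
Hypothesis E : embezzling_columns alpha r t psi.

Let A := columns_with_adjoints r.
Let orbit := range (word_sum r psi).

Lemma columns_bounded i : bounded_op (r i). Proof. by case: E => [[]]. Qed.
Lemma rows_bounded i : bounded_op (t i). Proof. by case: E => [[]]. Qed.
Hint Resolve columns_bounded rows_bounded : core.

Lemma rows_commutant j : commutant A (t j).
Proof.
have [_ [rt rta] _ _ _] := E; have [_ [_ tra] _ _ _] := embezzling_columns_sym E.
apply: commutant_columns => //; case=> i [] v; rewrite /letter_op /=; first exact: tra.
by rewrite rt.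
Qed.

Lemma rows_adjoint_commutant j : commutant A (adjoint (t j)).
Proof. exact: commutant_adjoint (columns_self_adjoint columns_bounded) (rows_commutant j). Qed.

(** [t_j] commutes past the word and turns into [alpha_j r_j^*] on [psi]: the rows act on word
    vectors by multiplication on the right. *)
Lemma row_word j w : t j (word_op r w psi) =
  (alpha j)%:C%C *: word_op r (rcons w (j, true)) psi.
Proof.
rewrite (commutant_word _ _ (rows_commutant j)) (column_adjoint alpha_unit E).
rewrite (linZ (bounded_op_lin (word_bounded columns_bounded w))).
by rewrite -cats1 word_op_cat.
Qed.

Lemma row_adjoint_word j w : adjoint (t j) (word_op r w psi) =
  (alpha j)^-1%:C%C *: word_op r (rcons w (j, false)) psi.
Proof.
rewrite (commutant_word _ _ (rows_adjoint_commutant j)).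
rewrite (adjoint_column alpha_gt0 alpha_unit (embezzling_columns_sym E)).
rewrite (linZ (bounded_op_lin (word_bounded columns_bounded w))).
by rewrite -cats1 word_op_cat.
Qed.

Lemma row_word_sum j p : t j (word_sum r psi p) =
  word_sum r psi [seq (x.1 * (alpha j)%:C%C, rcons x.2 (j, true)) | x <- p].
Proof.
apply: word_sum_apply => [|x]; first by case: (rows_bounded j).
by rewrite row_word scalerA.
Qed.

Lemma row_adjoint_word_sum j p : adjoint (t j) (word_sum r psi p) =
  word_sum r psi [seq (x.1 * (alpha j)^-1%:C%C, rcons x.2 (j, false)) | x <- p].
Proof.
apply: word_sum_apply => [|x]; first by case: (adjoint_bounded (rows_bounded j)).
by rewrite row_adjoint_word scalerA.
Qed.

Lemma letter_word_sum l p : letter_op r l (word_sum r psi p) =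
  word_sum r psi [seq (x.1, l :: x.2) | x <- p].
Proof.
by apply: word_sum_apply => // ; case: (letter_bounded columns_bounded l).
Qed.

Section WithProjection.
Variable G : H -> H.
Hypothesis GP : is_orthogonal_projection orbit G.

Let sO : subspace orbit := word_sum_subspace r psi.

Lemma orbit_word w : orbit (word_op r w psi).
Proof. by exists [:: (1, w)] => //; exact: word_sum_word. Qed.

Lemma orbit_proj_psi : G psi = psi.
Proof. by apply: (proj_id sO GP); apply: sub_adherent; exact: (orbit_word [::]). Qed.

Lemma orbit_proj_commutant : commutant A G.
Proof.
have inv l v : orbit v -> adherent orbit (letter_op r l v).
  by move=> [p _ <-]; apply: sub_adherent; rewrite letter_word_sum; eexists.
apply: commutant_columns => [|l v]; first exact/bounded_opP/(proj_bounded sO GP).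
symmetry; apply: (proj_commute sO GP (Y := letter_op r (l.1, ~~ l.2))).
- exact/bounded_opP/letter_bounded.
- exact: letter_adjoint.
- exact: inv.
- exact: inv.
Qed.

Lemma orbit_proj_rows j v : t j (G v) = G (t j v) /\ adjoint (t j) (G v) = G (adjoint (t j) v).
Proof.
have tj := adjointP (rows_bounded j).
have inv u : orbit u -> adherent orbit (t j u).
  by move=> [p _ <-]; apply: sub_adherent; rewrite row_word_sum; eexists.
have inva u : orbit u -> adherent orbit (adjoint (t j) u).
  by move=> [p _ <-]; apply: sub_adherent; rewrite row_adjoint_word_sum; eexists.
split.
  by apply: (proj_commute sO GP _ tj inv inva); exact/bounded_opP.
apply: (proj_commute sO GP _ (is_adjointC tj) inva inv).
exact/bounded_opP/adjoint_bounded.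
Qed.

(** By induction, if [w psi = n psi] and [l psi = m psi], then [l w psi = n l psi = n m psi]: the
    order of the factors is reversed. Commutation with [G] is recorded so that [n] can be compressed
    to the corner. *)
Lemma word_eq_commutant w : exists n,
  [/\ commutant A n, forall v, n (G v) = G (n v) & word_op r w psi = n psi].
Proof.
elim: w => [|l w [n [nA nG wn]]].
  by exists idfun; split=> //; exact: commutant_id.
have Al := columns_self_adjoint columns_bounded.
suff [m [mA mG lm]] : exists m, [/\ commutant A m, forall v, m (G v) = G (m v)
    & letter_op r l psi = m psi].
  exists (n \o m); split=> [|v|] /=; first exact: commutant_comp.
  - by rewrite mG nG.
  - by rewrite wn -(commutant_letter _ _ nA) lm.
case: l => i []; rewrite /letter_op /=.
- exists ((alpha i)^-1%:C%C *: t i); split.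
  + apply: commutantZ (rows_commutant i); exact: Al.1.
  + move=> v; have [tG _] := orbit_proj_rows i v.
    by rewrite (linZ (proj_linear sO GP)) -tG.
  + by rewrite (adjoint_column alpha_gt0 alpha_unit E).
- exists ((alpha i)%:C%C *: adjoint (t i)); split.
  + apply: commutantZ (rows_adjoint_commutant i); exact: Al.1.
  + move=> v; have [_ tG] := orbit_proj_rows i v.
    by rewrite (linZ (proj_linear sO GP)) -tG.
  + by rewrite (column_adjoint alpha_unit (embezzling_columns_sym E)).
Qed.

(** For the rotation rule, the letter moves across the inner product onto [psi], is exchanged there
    for a row operator, which moves back, commutes past [w] and is exchanged again; each exchange
    contributes one factor [alpha_i] or its inverse. For the deletion rule, the tail [v psi] is
    written as [n psi] with [n] in the commutant, so the relation is needed at [psi] only. *)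
Lemma protocol_moment_rules : moment_rules alpha (moment r psi).
Proof.
have [_ _ _ psi1 _] := E; split.
- by rewrite /moment inner_sqnorm psi1.
- move=> l w; rewrite /moment [word_op _ (_ :: _) _]/(letter_op r l (word_op r w psi)).
  rewrite letter_adjoint // -cats1 word_op_cat [word_op _ [:: l] _]/(letter_op r l psi).
  case: l => i []; rewrite /letter_op /weight /=.
  + rewrite (column_adjoint alpha_unit (embezzling_columns_sym E)) innerZr.
    rewrite conj_real_complex -(adjointP (rows_bounded i)).
    rewrite (commutant_word _ _ (rows_commutant i)) (column_adjoint alpha_unit E).
    rewrite (linZ (bounded_op_lin (word_bounded columns_bounded w))) innerZl mulrA.
    by rewrite -rmorphM.
  + rewrite (adjoint_column alpha_gt0 alpha_unit E) innerZr conj_real_complex.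
    rewrite -(is_adjointC (adjointP (rows_bounded i))).
    rewrite (commutant_word _ _ (rows_adjoint_commutant i)).
    rewrite (adjoint_column alpha_gt0 alpha_unit (embezzling_columns_sym E)).
    rewrite (linZ (bounded_op_lin (word_bounded columns_bounded w))) innerZl mulrA.
    by rewrite -rmorphM -expr2 exprVn.
- move=> u i j v; rewrite /moment word_op_cat /=.
  have [n [nA _ vn]] := word_eq_commutant v.
  have nl l x : letter_op r l (n x) = n (letter_op r l x) by rewrite (commutant_letter _ _ nA).
  rewrite vn !nl /letter_op /=.
  rewrite (column_cuntz alpha_gt0 alpha_unit E).
  case: eqP => _; first by rewrite -vn word_op_cat.
  rewrite (lin0 (bounded_op_lin nA.1)).
  by rewrite (lin0 (bounded_op_lin (word_bounded columns_bounded u))) inner0l.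
Qed.

End WithProjection.
End ProtocolSpace.

(** * Supports and corners *)

Section Projections.
Context {R : realType} {H : hilbertType R}.
Implicit Types (X Y E F : H -> H).

Lemma projection_inner X v : projection X -> inner (X v) v = (sqnorm (X v))%:C%C.
Proof.
move=> [_ XX Xa]; rewrite -inner_sqnorm [RHS]Xa.
by have /= -> := congr1 (fun f => f v) XX; rewrite -Xa.
Qed.

Lemma projectionK X v : projection X -> X (X v) = X v.
Proof. by move=> [_ XX _]; exact: (congr1 (fun f => f v) XX). Qed.

Lemma complementE X v : (idfun - X) v = v - X v.
Proof. by []. Qed.

Lemma projection_complement X : projection X -> projection (idfun - X).
Proof.
move=> XP; have [Xb _ Xa] := XP.
have cE := complementE X.
split.
- rewrite -[- X]scaleN1r; apply: bounded_opD; [exact: bounded_op_id|exact: bounded_opZ].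
- apply/funext => v; rewrite -[LHS]/((idfun - X) ((idfun - X) v)) !cE.
  by rewrite (linB (bounded_op_lin Xb)) projectionK // subrr subr0.
- by move=> u v; rewrite !cE innerBl innerBr Xa.
Qed.

Lemma projection_sqnorm_le X v : projection X -> sqnorm (X v) <= sqnorm v.
Proof.
move=> XP; have E1 : re_inner (X v) v = sqnorm (X v) by rewrite /re_inner projection_inner.
by have := re_inner_le (X v) v; rewrite E1; lra.
Qed.

Lemma op_le_projection_eq0 E F v : projection E -> projection F -> op_le E F ->
  F v = 0 -> E v = 0.
Proof.
move=> EP FP EF Fv; apply: sqnorm_eq0; apply/eqP; rewrite eq_le sqnorm_ge0 andbT.
have := EF v; rewrite !projection_inner // Fv lecR sqnorm0; exact.
Qed.

(** [E <= F] gives [E = E F], while [F <= E] gives [F = F E], whose adjoint is [F = E F]. *)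
Lemma op_le_projection_anti E F : projection E -> projection F ->
  op_le E F -> op_le F E -> E = F.
Proof.
have main E' F' v : projection E' -> projection F' -> op_le E' F' -> E' v = E' (F' v).
  move=> E'P F'P EF; apply/eqP; rewrite -subr_eq0.
  have [E'b _ _] := E'P; have [F'b _ _] := F'P.
  rewrite -(linB (bounded_op_lin E'b)); apply/eqP.
  apply: (op_le_projection_eq0 E'P F'P EF).
  by rewrite (linB (bounded_op_lin F'b)) projectionK // subrr.
move=> EP FP EF FE; apply/funext => v; apply: inner_ext => w.
have [_ _ Ea] := EP; have [_ _ Fa] := FP.
by rewrite (main _ _ v EP FP EF) Ea Fa -(main _ _ w FP EP FE) -Fa.
Qed.

Lemma op_le_complement X F : projection X -> projection F ->
  (forall v, X (F v) = 0) -> op_le X (idfun - F).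
Proof.
move=> XP FP XF v; have [Xb _ _] := XP.
rewrite !projection_inner //; last exact: projection_complement.
rewrite lecR; apply: le_trans (projection_sqnorm_le _ XP).
by rewrite complementE (linB (bounded_op_lin Xb)) XF subr0.
Qed.

Lemma projection_kernel X psi : projection X -> inner (X psi) psi = 0 -> X psi = 0.
Proof.
by move=> XP; rewrite projection_inner // => /(@complexI R) /sqnorm_eq0.
Qed.

End Projections.

Section ProtocolCorner.
Context {R : realType} {H : hilbertType R} {d : nat}.
Variables (alpha : 'I_d -> R) (r t : 'I_d -> H -> H) (psi : H).
Hypotheses (alpha_gt0 : forall i, 0 < alpha i) (alpha_unit : \sum_i alpha i ^+ 2 = 1).
Hypothesis E : embezzling_columns alpha r t psi.
Variable G : H -> H.
Hypothesis GP : is_orthogonal_projection (range (word_sum r psi)) G.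

Let A := columns_with_adjoints r.
Let N := generated_von_neumann [set r i | i in [set: 'I_d]].
Let sO := word_sum_subspace r psi.

Let columns_set_bounded X : [set r i | i in [set: 'I_d]] X -> bounded_op X.
Proof. by move=> [i _ <-]; exact: columns_bounded E i. Qed.

Lemma generated_columns : N = commutant (commutant A).
Proof. exact: (generated_bicommutant columns_set_bounded). Qed.

Lemma commutant_generated_columns : commutant N = commutant A.
Proof. exact: (commutant_generated columns_set_bounded). Qed.

Lemma orbit_projection : projection G.
Proof.
split; first exact/bounded_opP/(proj_bounded sO GP).
- by apply/funext => v; exact: projK sO GP v.
- exact: proj_adjoint GP.
Qed.

Lemma eq_on_orbit (X Y : H -> H) : bounded_op X -> bounded_op Y ->
  (forall w, X (word_op r w psi) = Y (word_op r w psi)) -> forall v, X (G v) = Y (G v).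
Proof.
move=> Xb Yb XY v.
apply: (bounded_eq_adherent ((bounded_opP X).1 Xb) ((bounded_opP Y).1 Yb) _
  (proj_adherent GP v)) => _ [p _ <-].
rewrite /word_sum (linS (bounded_op_lin Xb)) (linS (bounded_op_lin Yb)).
apply: eq_bigr => x _.
by rewrite (linZ (bounded_op_lin Xb)) (linZ (bounded_op_lin Yb)) XY.
Qed.

(** [1 - G] is the largest projection in the commutant that kills [psi]: any other one commutes with
    words, so it kills the whole orbit. *)
Lemma support_commutant P' : is_support (commutant N) psi P' -> P' = G.
Proof.
rewrite commutant_generated_columns => -[F [FP Fub Fleast] ->].
have GPr := orbit_projection; have cP := projection_complement GPr.
suff -> : F = idfun - G by apply/funext => v; rewrite !complementE opprB addrC subrK.
apply: op_le_projection_anti => //.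
- apply: Fleast => // X [XA XP /(projection_kernel XP) Xpsi].
  apply: op_le_complement => // v.
  apply: (@eq_on_orbit X 0) => //; [exact: XA.1|exact: bounded_op0|move=> w].
  rewrite (commutant_word _ _ XA) Xpsi.
  by rewrite (lin0 (bounded_op_lin (word_bounded (columns_bounded E) w))).
- have ApG : (idfun - G) psi = 0.
    by rewrite complementE (orbit_proj_psi GP) subrr.
  apply: Fub; split=> //; last by rewrite ApG inner0l.
  have Ab := (columns_self_adjoint (columns_bounded E)).1.
  rewrite -[- G]scaleN1r; apply: commutantD => //; first exact: commutant_id.
  by apply: commutantZ (orbit_proj_commutant E GP).
Qed.

(** A projection in the generated algebra that kills [psi] kills every [n psi] with [n] in the
    commutant, hence every word vector. The inclusion of ranges is all that the product of the two
    supports requires. *)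
Lemma support_generated P : is_support N psi P -> forall v, P (G v) = G v.
Proof.
rewrite generated_columns => -[F [FP Fub Fleast] ->] v.
have GPr := orbit_projection; have cP := projection_complement GPr.
suff FG : F (G v) = 0 by rewrite complementE FG subr0.
apply: (op_le_projection_eq0 FP cP); last first.
  by rewrite complementE projectionK // subrr.
apply: Fleast => // X [XA XP /(projection_kernel XP) Xpsi].
apply: op_le_complement => // v'.
apply: (@eq_on_orbit X 0) => //; [exact: XA.1|exact: bounded_op0|move=> w].
have [n [nA _ ->]] := word_eq_commutant alpha_gt0 alpha_unit E GP w.
by rewrite (commutant_app XA nA) Xpsi (lin0 (bounded_op_lin nA.1)).
Qed.

Lemma corner_generated Z : bounded_op Z ->
  (forall v, Z (G v) = Z v) -> (forall v, G (Z v) = Z v) ->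
  (forall c, commutant A c -> (forall v, c v = G (c (G v))) ->
     forall v, Z (c v) = c (Z v)) ->
  exists2 Y, N Y & forall v, G (Y (G v)) = Z v.
Proof.
move=> Zb ZG GZ Zc; have As := columns_self_adjoint (columns_bounded E).
have GA := orbit_proj_commutant E GP.
have GK := projK sO GP; have Gpsi := orbit_proj_psi GP.
have [Y [YA Yn]] := corner_lift As GA GK (proj_adjoint GP) Gpsi Zb ZG GZ Zc.
exists Y; first by rewrite generated_columns.
move=> v; rewrite -[RHS]GZ -[Z v]ZG; congr (G _).
apply: eq_on_orbit => //; first exact: YA.1.
move=> w; have [n [nA nG ->]] := word_eq_commutant alpha_gt0 alpha_unit E GP w.
rewrite Yn //.
(* [G n G] lies in the corner, so [Z] commutes with it; at [psi], as [n] commutes with [G], this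
   reads [Z (n psi) = n (Z psi)]. *)
have cA : commutant A (G \o (n \o G)) by do 2!apply: commutant_comp => //.
have cG v' : (G \o (n \o G)) v' = G ((G \o (n \o G)) (G v')) by rewrite /= !GK.
by have := Zc _ cA cG psi; rewrite /= Gpsi -nG GZ -nG Gpsi GZ.
Qed.

End ProtocolCorner.

(** * Comparison of two protocols *)

Section FromProtocol.
Context {R : realType} {H : hilbertType R} {d : nat}.
Implicit Types (A B : 'M[H -> H]_d) (M : set (H -> H)).

(** The contraction is tested on the tuple with [v] in slot [o] and zero elsewhere. *)
Lemma block_column_le A o v : (forall i j, linear (A i j)) -> Defs.contraction (block_op A) ->
  \sum_i sqnorm (A i o v) <= sqnorm v.
Proof.
move=> lA /(_ (single o v)); rewrite !inner_sqnorm lecR sqnorm_single sqnorm_ffun.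
under eq_bigr => i _.
  rewrite ffunE (bigD1 o) //= ffunE eqxx big1 ?addr0; last first.
    by move=> j jo; rewrite ffunE (negbTE jo) (lin0 (lA i j)).
  over.
exact.
Qed.

Lemma protocol_columns (o : 'I_d) (alpha : 'I_d -> R) M A B psi : von_neumann M ->
  embezzlement_protocol o alpha M A B psi ->
  embezzling_columns alpha (fun i => A i o) (fun j => B j o) psi.
Proof.
move=> vM [[MA Ac] [MB Bc] psi1 main].
have [Mb Ma] := von_neumann_self_adjoint vM.
have Ab i j : bounded_op (A i j) by exact: Mb.
have Bb i j : bounded_op (B i j) by case: (MB i j).
have lA i j := bounded_op_lin (Ab i j); have lB i j := bounded_op_lin (Bb i j).
have MBa i j : commutant M (adjoint (B i j)).
  by apply: commutant_adjoint.
split=> //.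
- split=> i j v; first by rewrite (commutant_app (MB j o) (MA i o)).
  by rewrite (commutant_app (MBa j o) (MA i o)).
- by split=> v; exact: block_column_le.
- have /eqP := normE_sqnorm psi; rewrite psi1 expr1n => /eqP h.
  by apply: (@complexI R); rewrite -h.
- move=> i j.
  have := congr1 (fun f : {ffun 'I_d * 'I_d -> H} => f (i, j)) main.
  rewrite ffunE /= (bigD1 o) //= ffunE /= (bigD1 o) //= ffunE /= eqxx.
  rewrite big1 ?addr0; last first.
    by move=> k ko; rewrite ffunE xpair_eqE eqxx /= (negbTE ko) (lin0 (lB j k)).
  rewrite big1 ?addr0; last first.
    move=> k ko; rewrite ffunE /= big1 ?(lin0 (lA i k)) // => l _.
    by rewrite ffunE xpair_eqE (negbTE ko) (lin0 (lB j l)).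
  move=> ->; rewrite sum_ffunE (bigD1 i) //= big1 ?addr0; last first.
    move=> k ki; rewrite !ffunE xpair_eqE (eq_sym i) (negbTE ki) /=.
    by rewrite scaler0.
  by rewrite !ffunE xpair_eqE eqxx /= eq_sym; case: eqP => // _; rewrite scaler0.
Qed.

End FromProtocol.

(** * Transport of operators and corners along the partial isometry *)

Section Transport.
Context {R : realType} {H K : hilbertType R} {d : nat}.
Variables (alpha : 'I_d -> R) (r t : 'I_d -> H -> H) (r' t' : 'I_d -> K -> K).
Variables (psi : H) (psi' : K) (G : H -> H) (G' : K -> K).
Hypotheses (alpha_gt0 : forall i, 0 < alpha i) (alpha_unit : \sum_i alpha i ^+ 2 = 1).
Hypotheses (E : embezzling_columns alpha r t psi) (E' : embezzling_columns alpha r' t' psi').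
Hypotheses (GP : is_orthogonal_projection (range (word_sum r psi)) G)
  (GP' : is_orthogonal_projection (range (word_sum r' psi')) G').

Lemma pair_projl (u : H -> K) (u' : K -> H) v : partial_isometry_pair G G' u u' -> u (G v) = u v.
Proof.
move=> [[lu _] _ uu' u'u _]; apply/eqP; rewrite eq_sym -subr_eq0 -(linB lu).
have GK := projK (word_sum_subspace r psi) GP.
have lG := proj_linear (word_sum_subspace r psi) GP.
apply/eqP/sqnorm_eq0; rewrite /sqnorm /re_inner uu' u'u.
by rewrite (linB lG) GK subrr inner0r.
Qed.

Lemma pair_projr (u : H -> K) (u' : K -> H) v : partial_isometry_pair G G' u u' -> G' (u v) = u v.
Proof.
by move=> P; have [_ _ _ u'u uu'] := P; rewrite -uu' u'u (pair_projl _ P).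
Qed.

(** [f] is the common formal action of [X] and [X'] on lists of words. It gives the identity on word
    sums, then by density on the range of [G]; both sides vanish on the complement. *)
Lemma pair_intertwine (u : H -> K) (u' : K -> H) (X : H -> H) (X' : K -> K)
    (f : R[i] * seq ('I_d * bool) -> R[i] * seq ('I_d * bool)) :
  partial_isometry_pair G G' u u' ->
  (forall p, u (word_sum r psi p) = word_sum r' psi' p) ->
  bounded_op X -> bounded_op X' -> (forall v, X (G v) = G (X v)) ->
  (forall p, X (word_sum r psi p) = word_sum r psi (map f p)) ->
  (forall p, X' (word_sum r' psi' p) = word_sum r' psi' (map f p)) ->
  forall v, u (X v) = X' (u v).
Proof.
move=> P uw /bounded_opP[lX [k [k0 Xk]]] /bounded_opP[lX' [k' [k'0 Xk']]] XG Xf Xf' v.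
have [[lu [a [a0 ua]]] _ _ _ _] := P.
rewrite -(pair_projl (X v) P) -XG -(pair_projl v P).
apply: (bounded_eq_adherent (X := u \o X) (Y := X' \o u) _ _ _ (proj_adherent GP v)).
- split; first by move=> c x y /=; rewrite lX lu.
  exists (a * k); split=> [|x]; first exact: mulr_ge0.
  by rewrite -mulrA; apply: le_trans (ua _) _; rewrite ler_wpM2l.
- split; first by move=> c x y /=; rewrite lu lX'.
  exists (k' * a); split=> [|x]; first exact: mulr_ge0.
  by rewrite -mulrA; apply: le_trans (Xk' _) _; rewrite ler_wpM2l.
- by move=> _ [p _ <-] /=; rewrite Xf !uw Xf'.
Qed.

Section Corners.
Variables (u : H -> K) (u' : K -> H).
Hypotheses (P : partial_isometry_pair G G' u u')
  (ul : forall l v, u (letter_op r l v) = letter_op r' l (u v))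
  (u'l : forall l v, u' (letter_op r' l v) = letter_op r l (u' v))
  (u'GK : forall v, u' (G' v) = u' v) (Gu' : forall v, G' (u v) = u v).

Let N := generated_von_neumann [set r i | i in [set: 'I_d]].
Let N' := generated_von_neumann [set r' i | i in [set: 'I_d]].

Lemma conjugate_bounded (L1 L2 : hilbertType R) (w : L1 -> L2) (w' : L2 -> L1) (X : L1 -> L1) :
  bounded_linear w -> bounded_linear w' -> bounded_op X ->
  bounded_op (fun v => w (X (w' v))).
Proof.
move=> [lw [a [a0 wa]]] [lw' [b [b0 wb]]] /bounded_opP[lX [k [k0 Xk]]].
apply/bounded_opP; split; first by move=> c x y /=; rewrite lw' lX lw.
exists (a * (k * b)); split=> [|x]; first by rewrite !mulr_ge0.
rewrite -!mulrA; apply: le_trans (wa _) _; rewrite ler_wpM2l //.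
by apply: le_trans (Xk _) _; rewrite ler_wpM2l.
Qed.

Lemma transport_commutant X : commutant N X ->
  exists2 Y, commutant N' Y & forall v, G' (Y (G' v)) = u (X (u' v)).
Proof.
rewrite (commutant_generated_columns E) (commutant_generated_columns E') => XA.
have [ub u'b _ _ _] := P.
exists (fun v => u (X (u' v))); last by move=> v; rewrite u'GK Gu'.
apply: commutant_columns; first exact: conjugate_bounded ub u'b XA.1.
by move=> l v; rewrite u'l (commutant_letter _ _ XA) ul.
Qed.

(** Here [u X u'] is only the compression of the element sought, which [corner_generated] supplies.
    Its commutation hypothesis holds because an element [c] of the corner of the commutant pulls
    back to [u' c u], which commutes with the first columns and hence with [X]. *)
Lemma transport_generated X : N X ->
  exists2 Y, N' Y & forall v, G' (Y (G' v)) = u (X (u' v)).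
Proof.
rewrite /N (generated_columns E) => XA; have [ub u'b _ _ uu'] := P.
apply: (corner_generated alpha_gt0 alpha_unit E' GP').
- exact: conjugate_bounded ub u'b XA.1.
- by move=> v; rewrite u'GK.
- by move=> v; rewrite Gu'.
move=> c cA cG v; have Gc x : G' (c x) = c x.
  by rewrite cG (projK (word_sum_subspace r' psi') GP').
have cGK x : c (G' x) = c x.
  by rewrite cG (projK (word_sum_subspace r' psi') GP') -cG.
have c1A : commutant (columns_with_adjoints r) (fun x => u' (c (u x))).
  apply: commutant_columns; first exact: conjugate_bounded u'b ub cA.1.
  by move=> l x; rewrite ul (commutant_letter _ _ cA) u'l.
rewrite -cGK -uu' [X in u X](commutant_app XA c1A).
by rewrite uu' Gc.
Qed.

End Corners.
End Transport.

Definition ran_map (R : realType) (L L' : preHilbertType R) (T : {linear L -> L})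
  (T' : {linear L' -> L'}) (w : L -> L') (x : ran T) : ran T' := to_ran T' (w (ran_val x)).
Arguments ran_map {R L L'} T T' w x.

Lemma ran_fixed (R : realType) (L : preHilbertType R) (T : {linear L -> L}) (x : ran T) :
  (forall v, T (T v) = T v) -> T (ran_val x) = ran_val x.
Proof. by case: x => x /= /in_ranP[y <-] ->. Qed.

Section Corners.
Context {R : realType} {H K : hilbertType R}.
Variables (Q : {linear H -> H}) (Q' : {linear K -> K}) (u : H -> K) (u' : K -> H).
Hypotheses (QQ : forall v, Q (Q v) = Q v) (QQ' : forall w, Q' (Q' w) = Q' w).
Hypothesis P : partial_isometry_pair Q Q' u u'.
Hypotheses (uQ : forall v, u (Q v) = u v) (Qu : forall v, Q' (u v) = u v)
  (Qu' : forall w, Q (u' w) = u' w).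

Lemma ran_map_unitary : unitary (ran_map Q Q' u).
Proof.
have [[lu _] _ uu' u'u uu'Q] := P.
split.
- move=> c x y; apply: val_inj.
  transitivity (u (c *: ran_val x + ran_val y)).
    rewrite /= Qu; congr (u _); exact: (linearP (\val : ran Q -> H)).
  rewrite lu -[u (ran_val x)]Qu -[u (ran_val y)]Qu; symmetry.
  exact: (linearP (\val : ran Q' -> K)).
- move=> x y; rewrite -[LHS]/(inner (Q' (u (ran_val x))) (Q' (u (ran_val y)))) !Qu uu' u'u.
  by rewrite ran_fixed.
- move=> y; exists (to_ran Q (u' (ran_val y))); apply: val_inj => /=.
  by rewrite Qu uQ uu'Q ran_fixed.
Qed.

Lemma ran_map_adjoint : adjoint (ran_map Q Q' u) = ran_map Q' Q u'.
Proof.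
have [_ _ uu' _ _] := P; apply: adjoint_eq => x y.
rewrite -[LHS]/(inner (Q' (u (ran_val x))) (ran_val y)).
by rewrite -[RHS]/(inner (ran_val x) (Q (u' (ran_val y)))) Qu Qu' uu'.
Qed.

Lemma ran_map_conj X Y : (forall w, Q' (Y (Q' w)) = u (X (u' w))) ->
  ran_map Q Q' u \o compress Q X \o adjoint (ran_map Q Q' u) = compress Q' Y.
Proof.
move=> XY; rewrite ran_map_adjoint; apply/funext => y; apply: val_inj => /=.
by rewrite XY Qu uQ !Qu'.
Qed.

End Corners.

Lemma word_sum_inner (R : realType) (H : hilbertType R) d (r : 'I_d -> H -> H) psi p q :
  (forall i, bounded_op (r i)) ->
  inner (word_sum r psi p) (word_sum r psi q) =
  \sum_(x <- p) \sum_(y <- q) x.1 * (y.1^* * moment r psi (adjoint_word y.2 ++ x.2)).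
Proof.
move=> rb; rewrite /word_sum inner_suml; apply: eq_bigr => x _.
rewrite inner_sumr; apply: eq_bigr => y _.
by rewrite innerZl innerZr inner_words.
Qed.

(** Inner products of word sums are expressed through moments, which agree for the two protocols; so
    evaluating the same list on both sides is an isometric relation. *)
Lemma protocols_isometry (R : realType) (H K : hilbertType R) d (alpha : 'I_d -> R)
    (r t : 'I_d -> H -> H) (r' t' : 'I_d -> K -> K) psi psi' G G' :
  (forall i, 0 < alpha i) -> (forall i, alpha i < 1) -> \sum_i alpha i ^+ 2 = 1 ->
  embezzling_columns alpha r t psi -> embezzling_columns alpha r' t' psi' ->
  is_orthogonal_projection (range (word_sum r psi)) G ->
  is_orthogonal_projection (range (word_sum r' psi')) G' ->
  exists u u', [/\ partial_isometry_pair G G' u u', u psi = psi',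
    forall l v, u (letter_op r l v) = letter_op r' l (u v),
    forall l v, u' (letter_op r' l v) = letter_op r l (u' v)
    & forall j v, u (adjoint (t j) v) = adjoint (t' j) (u v)].
Proof.
move=> a0 a1 a2 E E' GP GP'.
pose D := [set (word_sum r psi p, word_sum r' psi' p) | p in setT].
have D1 : fst @` D = range (word_sum r psi).
  apply/seteqP; split=> [_ [_ [p _ <-] <-]|_ [p _ <-]]; first by exists p.
  by exists (word_sum r psi p, word_sum r' psi' p) => //; exists p.
have D2 : snd @` D = range (word_sum r' psi').
  apply/seteqP; split=> [_ [_ [p _ <-] <-]|_ [p _ <-]]; first by exists p.
  by exists (word_sum r psi p, word_sum r' psi' p) => //; exists p.
have rb := columns_bounded E; have rb' := columns_bounded E'.
have mm : moment r psi =1 moment r' psi'.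
  apply: (moment_unique a0 a1); first exact: (protocol_moment_rules a0 a2 E GP).
  exact: (protocol_moment_rules a0 a2 E' GP').
have [||||||u [u' [P uD]]] := @partial_isometry_extension _ _ _ D G G' _ _ _ _
    hilbert_complete hilbert_complete; rewrite ?D1 ?D2 //.
- by exists [::] => //; rewrite !word_sum_nil.
- move=> _ _ [p _ <-] [q _ <-]; exists ([seq (1 * x.1, x.2) | x <- p] ++ q) => //.
  by rewrite !word_sum_comb !scale1r.
- move=> c _ [p _ <-]; exists ([seq (c * x.1, x.2) | x <- p] ++ [::]) => //.
  by rewrite !word_sum_comb !word_sum_nil !addr0.
- move=> _ _ [p _ <-] [q _ <-] /=; rewrite !word_sum_inner //.
  by apply: eq_bigr => x _; apply: eq_bigr => y _; rewrite mm.
have uw p : u (word_sum r psi p) = word_sum r' psi' p.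
  by have [] := uD (word_sum r psi p, word_sum r' psi' p); first by exists p.
have u'w p : u' (word_sum r' psi' p) = word_sum r psi p.
  by have [] := uD (word_sum r psi p, word_sum r' psi' p); first by exists p.
have P' : partial_isometry_pair G' G u' u.
  by have [ub u'b uu' u'u uu'G] := P; split=> //; exact: is_adjointC.
exists u, u'; split=> //.
- by have := uw [:: (1, [::])]; rewrite !word_sum_word.
- move=> l; apply: (pair_intertwine GP P uw (letter_bounded rb l) (letter_bounded rb' l)
    (fun v => esym (commutant_letter l v (orbit_proj_commutant E GP)))).
    exact: (letter_word_sum E l).
  exact: (letter_word_sum E' l).
- move=> l; apply: (pair_intertwine GP' P' u'w (letter_bounded rb' l) (letter_bounded rb l)
    (fun v => esym (commutant_letter l v (orbit_proj_commutant E' GP')))).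
    exact: (letter_word_sum E' l).
  exact: (letter_word_sum E l).
- move=> j; apply: (pair_intertwine GP P uw (adjoint_bounded (rows_bounded E j))
    (adjoint_bounded (rows_bounded E' j))
    (fun v => (orbit_proj_rows a0 a2 E GP j v).2)).
    exact: (row_adjoint_word_sum a0 a2 E j).
  exact: (row_adjoint_word_sum a0 a2 E' j).
Qed.

Theorem theorem3p5 (R : realType) (d : nat) (d_gt1 : (1 < d)%N)
    (alpha : 'I_d -> R)
    (alpha_noninc : forall i j : 'I_d, (i <= j)%N -> alpha j <= alpha i)
    (alpha_gt0 : forall i, 0 < alpha i)
    (alpha_unit : \sum_i alpha i ^+ 2 = 1)
    (H1 H2 : hilbertType R)
    (M1 : set (H1 -> H1)) (M2 : set (H2 -> H2))
    (vnM1 : von_neumann M1) (vnM2 : von_neumann M2)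
    (ndM1 : nondegenerate_algebra M1) (ndM2 : nondegenerate_algebra M2)
    (R1 T1 : 'M[H1 -> H1]_d) (R2 T2 : 'M[H2 -> H2]_d)
    (psi1 : H1) (psi2 : H2) :
  let o : 'I_d := Ordinal (ltnW d_gt1) in
  embezzlement_protocol o alpha M1 R1 T1 psi1 ->
  embezzlement_protocol o alpha M2 R2 T2 psi2 ->
  let N1 := generated_von_neumann [set R1 i o | i in [set: 'I_d]] in
  let N2 := generated_von_neumann [set R2 i o | i in [set: 'I_d]] in
  forall (P1 P1' : {linear H1 -> H1}) (P2 P2' : {linear H2 -> H2}),
  is_support N1 psi1 P1 -> is_support (commutant N1) psi1 P1' ->
  is_support N2 psi2 P2 -> is_support (commutant N2) psi2 P2' ->
  let Q1 : {linear H1 -> H1} := P1 \o P1' in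
  let Q2 : {linear H2 -> H2} := P2 \o P2' in
  let V1 j := compress Q1 (adjoint (R1 j o)) in
  let V2 j := compress Q2 (adjoint (R2 j o)) in
  let W1 j := compress Q1 (adjoint (T1 j o)) in
  let W2 j := compress Q2 (adjoint (T2 j o)) in
  exists U : ran Q1 -> ran Q2,
    [/\ unitary U
      , exists2 x : ran Q1, ran_val x = psi1 & ran_val (U x) = psi2
      , forall j, U \o V1 j \o adjoint U = V2 j /\ U \o W1 j \o adjoint U = W2 j
      , [set U \o X \o adjoint U | X in corner Q1 N1] = corner Q2 N2
      & [set U \o X \o adjoint U | X in corner Q1 (commutant N1)] =
        corner Q2 (commutant N2)].
Proof.
move=> o prot1 prot2 N1 N2 P1 P1' P2 P2' sP1 sP1' sP2 sP2' Q1 Q2 V1 V2 W1 W2.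
have E1 := protocol_columns vnM1 prot1; have E2 := protocol_columns vnM2 prot2.
(* A second index exists because [d > 1], and its positive coefficient keeps [alpha i ^+ 2] strictly
   below the total 1. *)
have alpha_lt1 i : alpha i < 1.
  have [j ji] : exists j, j != i.
    have [i0|i0] := eqVneq i o; last by exists o; rewrite eq_sym.
    by exists (Ordinal d_gt1); rewrite i0.
  rewrite -(@expr_lt1 _ 2) ?ltW // -alpha_unit (bigD1 i) //= ltrDl.
  rewrite (bigD1 j) //= ltr_wpDr ?exprn_gt0 // sumr_ge0 // => k _.
  exact: sqr_ge0.
have proj (H : hilbertType R) (r t : 'I_d -> H -> H) psi (P P' : {linear H -> H}) :
    embezzling_columns alpha r t psi ->
    is_support (generated_von_neumann [set r i | i in [set: 'I_d]]) psi P ->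
    is_support (commutant (generated_von_neumann [set r i | i in [set: 'I_d]])) psi P' ->
    is_orthogonal_projection (range (word_sum r psi)) (P \o P').
  move=> E sP sP'.
  have [G GP] := orthogonal_projection_exists hilbert_complete (word_sum_subspace r psi).
  suff -> : P \o P' = G by [].
  apply/funext => v; rewrite /= (support_commutant E GP sP').
  exact: (support_generated alpha_gt0 alpha_unit E GP sP v).
have GP1 : is_orthogonal_projection _ Q1 := proj _ _ _ _ _ _ E1 sP1 sP1'.
have GP2 : is_orthogonal_projection _ Q2 := proj _ _ _ _ _ _ E2 sP2 sP2'.
(* From here on only the property of being the projection onto the orbit closure matters, so the
   products of supports are generalized to arbitrary linear maps. *)
move: Q1 Q2 @V1 @V2 @W1 @W2 GP1 GP2 => Q1 Q2 V1 V2 W1 W2 GP1 GP2.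
have [u [u' [P upsi ul u'l ut]]] :=
  protocols_isometry alpha_gt0 alpha_lt1 alpha_unit E1 E2 GP1 GP2.
have P' : partial_isometry_pair Q2 Q1 u' u.
  by have [ub u'b uu' u'u uu'G] := P; split=> //; exact: is_adjointC.
have uQ v := pair_projl GP1 v P; have Qu v := pair_projr GP1 v P.
have u'Q v := pair_projl GP2 v P'; have Qu' v := pair_projr GP2 v P'.
have QQ1 := projK (word_sum_subspace _ psi1) GP1.
have QQ2 := projK (word_sum_subspace _ psi2) GP2.
have [_ _ _ u'u uu'] := P.
have conj X Y := ran_map_conj P uQ Qu Qu' (X := X) (Y := Y).
have intertwined X Y : (forall v, u (X v) = Y (u v)) ->
    forall w, Q2 (Y (Q2 w)) = u (X (u' w)).
  by move=> uXY w; rewrite -(uu' w) -uXY Qu.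
(* Surjectivity onto the second corner transports [Y] back by [u']; this turns the resulting
   identity into the form expected by [conj]. *)
have backwards X Y : (forall v, Q1 (X (Q1 v)) = u' (Y (u v))) ->
    forall w, Q2 (Y (Q2 w)) = u (X (u' w)).
  by move=> XY w; rewrite -[u' w]Qu' -uQ XY !uu'.
exists (ran_map Q1 Q2 u); split.
- exact: (ran_map_unitary QQ1 QQ2 P uQ Qu).
- exists (to_ran Q1 psi1); rewrite /= (orbit_proj_psi GP1) //.
  by rewrite upsi (orbit_proj_psi GP2).
- move=> j; split; apply: conj; apply: intertwined; first exact: (ul (j, true)).
  exact: ut.
- apply/seteqP; split=> [_ [_ [X NX <-] <-]|_ [Y NY <-]].
    have [Y NY XY] := transport_generated alpha_gt0 alpha_unit E1 E2 GP2 P ul u'l u'Q Qu NX.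
    by exists Y => //; rewrite (conj X Y).
  have [X NX XY] := transport_generated alpha_gt0 alpha_unit E2 E1 GP1 P' u'l ul uQ Qu' NY.
  exists (compress Q1 X); first by exists X.
  exact/conj/backwards.
- apply/seteqP; split=> [_ [_ [X NX <-] <-]|_ [Y NY <-]].
    have [Y NY XY] := transport_commutant E1 E2 P ul u'l u'Q Qu NX.
    by exists Y => //; rewrite (conj X Y).
  have [X NX XY] := transport_commutant E2 E1 P' u'l ul uQ Qu' NY.
  exists (compress Q1 X); first by exists X.
  exact/conj/backwards.
Qed.
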